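(* Let $M\subset\mathbb{C}$ be a domain, $h$ a harmonic function on $M$, $\omega$ a finite signed Borel measure on $\mathbb{C}$ with compact support, and $z_0\in M$. For any $\epsilon>0$ and $\eta>0$ there exist $\delta>0$ with $\overline{Q_{\delta(1+\eta)}(z_0)}\subset M$, a constant $k\in\mathbb{R}$ and a finite signed Borel measure $\tilde\omega$ such that: (i) $\tilde\omega=\omega$ on $Q_\delta(z_0)$; (ii) $\tilde\omega=0$ outside $Q_{\delta(1+\eta)}(z_0)$; (iii) $|\tilde\omega|\big(Q_{\delta(1+\eta)}(z_0)\setminus\{z_0\}\big)<\epsilon$; (iv) on $Q_\delta(z_0)$ (wherever both sides are defined) $p(\omega,h)=p(\tilde\omega)+k$.
   Context: For a finite positive compactly supported measure $\mu$, $p(z;\mu)=\frac1{2\pi}\iint\ln|z-\zeta|\,d\mu(\zeta)$. For a finite signed compactly supported measure $\omega$ with Jordan decomposition $\omega=\omega^+-\omega^-$ and harmonic $h$, $p(\omega,h)=p(\omega^+)-p(\omega^-)+h$ and $p(\omega)=p(\omega,0)$; these are defined wherever $p(\omega^+)$ and $p(\omega^-)$ are not both $-\infty$. $|\omega|=\omega^++\omega^-$ is the total variation measure; $Q_r(z_0)$ is the open disc of center $z_0$, radius $r$. *)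

(* Defs.v *)
(* The complex plane C is modelled as R * R
   (R : realType), with the product sigma-algebra of Borel sets (= Borel
   sigma-algebra of R^2), the product topology and the EUCLIDEAN distance. *)
From HB Require Import structures.
From mathcomp Require Import all_boot all_order all_algebra.
From mathcomp Require Import all_classical all_reals all_analysis.
Set Implicit Arguments. Unset Strict Implicit. Unset Printing Implicit Defensive.
Import Order.TTheory GRing.Theory Num.Theory.
Import numFieldNormedType.Exports.
Local Open Scope classical_set_scope.
Local Open Scope ring_scope.

Definition cdist {R : realType} (z w : (R * R)%type) : R :=
  Num.sqrt ((z.1 - w.1) ^+ 2 + (z.2 - w.2) ^+ 2).

Definition Qdisc {R : realType} (z0 : (R * R)%type) (r : R) : set (R * R)%type :=
  [set z | cdist z z0 < r].

Definition domain {R : realType} (M : set (R * R)%type) : Prop :=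
  [/\ open M, connected M & M !=set0].

Definition pd {R : realType} (v : (R * R)%type) (f : (R * R)%type -> R) : (R * R)%type -> R :=
  fun z => 'D_v f z.

Definition ex {R : realType} : (R * R)%type := (1, 0).
Definition ey {R : realType} : (R * R)%type := (0, 1).

Definition harmonic_on {R : realType} (M : set (R * R)%type) (h : (R * R)%type -> R) : Prop :=
  forall z, M z ->
    [/\ (forall u, u = ex \/ u = ey -> derivable h z u),
        (forall u v, (u = ex \/ u = ey) -> (v = ex \/ v = ey) ->
           derivable (pd u h) z v /\ {for z, continuous (pd v (pd u h))})
      & pd ex (pd ex h) z + pd ey (pd ey h) z = 0].

(* Jordan decomposition of a (finite) signed measure, via a chosen Hahn
   decomposition (the result does not depend on the choice). *)
Definition hahn_PN {R : realType} d (T : measurableType d)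
  (nu : {charge set T -> \bar R}) :
  {PN : set T * set T | hahn_decomposition nu PN.1 PN.2}.
Proof.
have /cid [P /cid [N h]] := Hahn_decomposition nu.
exact: (exist _ (P, N) h).
Defined.

Definition jpos {R : realType} d (T : measurableType d)
  (nu : {charge set T -> \bar R}) := jordan_pos (svalP (hahn_PN nu)).
Definition jneg {R : realType} d (T : measurableType d)
  (nu : {charge set T -> \bar R}) := jordan_neg (svalP (hahn_PN nu)).

Definition tvar {R : realType} d (T : measurableType d)
  (nu : {charge set T -> \bar R}) (A : set T) : \bar R :=
  (jpos nu A + jneg nu A)%E.

Definition compact_support {R : realType} (nu : {charge set (R * R)%type -> \bar R}) :=
  exists K : set (R * R)%type, compact K /\
    forall A, measurable A -> A `&` K = set0 -> nu A = 0%E.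

Definition lnk {R : realType} (z w : (R * R)%type) : \bar R :=
  if z == w then -oo%E else (ln (cdist z w))%:E.

Definition pot {R : realType} (mu : {measure set (R * R)%type -> \bar R}) (z : (R * R)%type)
  : \bar R := (((2 * pi)^-1)%:E * \int[mu]_w lnk z w)%E.

Definition spot {R : realType} (om : {charge set (R * R)%type -> \bar R})
  (h : (R * R)%type -> R) (z : (R * R)%type) : \bar R :=
  (pot (jpos om) z - pot (jneg om) z + (h z)%:E)%E.

Definition spot_defined {R : realType} (om : {charge set (R * R)%type -> \bar R})
  (z : (R * R)%type) : Prop :=
  ~ (pot (jpos om) z = -oo%E /\ pot (jneg om) z = -oo%E).

(* Main.v *)
Require Import Defs.
From HB Require Import structures.
From mathcomp Require Import all_boot all_order all_algebra.
From mathcomp Require Import all_classical all_reals all_analysis.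
From mathcomp Require Import measurable_realfun ring lra.
Set Implicit Arguments. Unset Strict Implicit. Unset Printing Implicit Defensive.
Import Order.TTheory GRing.Theory Num.Theory.
Import numFieldNormedType.Exports.
Local Open Scope classical_set_scope.
Local Open Scope ring_scope.

(* Keep [omega] on a disc of radius [r1], and replace [h] and the potential of
   the rest of [omega] by a charge on a circle of radius [r], where
   [delta < r < r1 < delta * (1 + eta)].  This is possible because a function [u]
   harmonic near the closed disc of radius [r] is, inside it, [u z0] plus the
   logarithmic single layer potential whose density is [- r / pi] times the
   radial derivative of [u].  Indeed [f = u_x - i u_y] is holomorphic, and the
   Cauchy formula, together with its reflected version (which integrates to
   zero), shows that both sides have the same derivative along rays from [z0].

   The formula is applied to [h] and, under the integral sign, to [ln |. - w|]
   for [w] outside the disc of radius [r1].  The density obtained is [O (r)] for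
   [h] and [O (r / |w - z0|)] for the latter; since [r / |w - z0|] is bounded and
   the punctured discs around [z0] have [|omega|]-mass tending to zero, the total
   variation off [z0] is as small as wanted when [delta] tends to zero. *)

(** * Integrals over the circle *)

(** The factor [1 / pi] comes from reflection. Take [z0 = 0]. The function equal to [u] inside the
    circle and to [u (r^2 / conj z)] outside is continuous, tends to [u 0] at infinity, and its
    radial derivative jumps by [- 2 u_r]. Less its limit, it is the logarithmic potential of the
    density [- u_r / pi] per unit length, or [- r u_r / pi] per unit angle. This density has mean
    zero, so no further constant appears.

    The obstacle is (iii): the cost of sweeping mass that lies near the circle does not decrease
    with [delta]. The radii are therefore kept proportional, [r = delta (1 + eta / 3)] and
    [r1 = delta (1 + 2 eta / 3)], and the kernel is at most [c / pi] with
    [c = r / (r1 - r) = 1 + 3 / eta], whatever [delta]. Smallness comes from two choices, in this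
    order: [rho0] whose punctured disc has small mass, then [r] small against [rho0]. A mass at [z0]
    itself is never swept.

    Potentials may be infinite, but only through the mass in the disc of radius [r], where both
    charges coincide; the rest of (iv) is an identity between real numbers. *)

Section lambda_derivatives.
Context {R : realType}.
Implicit Types (f g : R -> R) (x : R).

(* Unlike [is_derive], not a type class, so that [apply:] leaves the premises
   as goals. *)
Definition has_der x f (a : R) : Prop := is_derive x 1 f a.

Lemma has_der_addf f g x a b : has_der x f a -> has_der x g b ->
  has_der x (fun y => f y + g y) (a + b).
Proof. by rewrite /has_der => ? ?; exact: is_deriveD. Qed.

Lemma has_der_subf f g x a b : has_der x f a -> has_der x g b ->
  has_der x (fun y => f y - g y) (a - b).
Proof. by rewrite /has_der => ? ?; exact: is_deriveB. Qed.

Lemma has_der_oppf f x a : has_der x f a ->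
  has_der x (fun y => - f y) (- a).
Proof. by rewrite /has_der => ?; exact: is_deriveN. Qed.

Lemma has_der_mulf f g x a b : has_der x f a -> has_der x g b ->
  has_der x (fun y => f y * g y) (f x * b + g x * a).
Proof. by rewrite /has_der => ? ?; exact: is_deriveM. Qed.

Lemma has_der_invf f x a : f x != 0 -> has_der x f a ->
  has_der x (fun y => (f y)^-1) (- a / f x ^+ 2).
Proof.
move=> fx0 [df dfE]; apply: DeriveDef; first exact: derivableV.
by rewrite deriveV// dfE /GRing.scale/= mulrC mulNr mulrN.
Qed.

Lemma has_der_idf x : has_der x id 1.
Proof. exact: is_derive_id. Qed.

Lemma has_der_cstf (c x : R) : has_der x (fun=> c) 0.
Proof. exact: is_derive_cst. Qed.

Lemma has_der_val_eq f x a b : has_der x f a -> a = b ->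
  has_der x f b.
Proof. by move=> ? <-. Qed.

Lemma has_der_continuous f x a : has_der x f a -> {for x, continuous f}.
Proof.
by move=> [df _]; apply: differentiable_continuous; exact/derivable1_diffP.
Qed.

Lemma derive0_eq f (u v a b : R) :
  (forall x, u < x < v -> has_der x f 0) ->
  u < a < v -> u < b < v -> f a = f b.
Proof.
move=> df; wlog ab : a b / a <= b.
  by move=> H auv buv; case/orP: (le_total a b) => ?; [|symmetry]; exact: H.
move=> /andP[ua av] /andP[ub bv].
have D x : a <= x <= b -> has_der x f 0.
  by move=> /andP[? ?]; apply: df; lra.
have [||c _] := @MVT_segment R f (fun=> 0) a b ab.
- by move=> x; rewrite in_itv/= => /andP[? ?]; apply: D; lra.
- apply: continuous_in_subspaceT => x; rewrite inE/= in_itv/= => xab.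
  exact: has_der_continuous (D _ xab).
- by rewrite mul0r => /subr0_eq.
Qed.

End lambda_derivatives.

Section circle_integral.
Context {R : realType}.
Local Notation mu := (@lebesgue_measure R).
Implicit Types (f g : R -> R).

(** Integration is in the angle; the arc length factor [r] is left to the integrands, where it
    enters through [circ r t]. *)
Definition cint f : R := \int[mu]_(t in `[0, 2 * pi]) f t.

Lemma twopi_gt0 : 0 < 2 * pi :> R.
Proof. by rewrite mulr_gt0// pi_gt0. Qed.

Lemma cint_integrable f : continuous f ->
  mu.-integrable `[0, 2 * pi] (EFin \o f).
Proof.
move=> cf; apply: continuous_compact_integrable; first exact: segment_compact.
exact: continuous_subspaceT.
Qed.

Lemma eq_cint f g : f =1 g -> cint f = cint g.
Proof. by move=> fg; apply: eq_Rintegral => x _; exact: fg. Qed.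

Lemma cintB f g : continuous f -> continuous g ->
  cint (fun t => f t - g t) = cint f - cint g.
Proof. by move=> cf cg; apply: RintegralB => //; exact: cint_integrable. Qed.

Lemma cintZ c f : continuous f -> cint (fun t => c * f t) = c * cint f.
Proof. by move=> cf; apply: RintegralZl => //; exact: cint_integrable. Qed.

Lemma cint_lin a b f g : continuous f -> continuous g ->
  cint (fun t => a * f t - b * g t) = a * cint f - b * cint g.
Proof.
move=> cf cg; rewrite -!cintZ// -cintB//.
- by move=> t; apply: cvgM; [exact: cvg_cst|exact: cf].
- by move=> t; apply: cvgM; [exact: cvg_cst|exact: cg].
Qed.

Lemma cint_cst c : cint (fun=> c) = c * (2 * pi).
Proof.
rewrite /cint Rintegral_cst//= lebesgue_measure_itv/= lte_fin twopi_gt0.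
by rewrite -EFinD/= subr0.
Qed.

Lemma cint_derive (F f : R -> R) : (forall t : R, has_der t F (f t)) ->
  continuous f -> cint f = F (2 * pi) - F 0.
Proof.
move=> dF cf; rewrite /cint /Rintegral (@continuous_FTC2 R f F)//.
- exact: twopi_gt0.
- exact: continuous_subspaceT.
- have cF x : {for x, continuous F} by exact: has_der_continuous (dF x).
  split.
  + by move=> x _; have [] := dF x.
  + by apply: cvg_at_right_filter; exact: cF.
  + by apply: cvg_at_left_filter; exact: cF.
- by move=> x _; rewrite derive1E; have [] := dF x.
Qed.

(** The constant [C] is the dominating function, integrable because the range of angles is bounded.
    The parameter interval is open, so the applications let [s] run a little beyond [[0, 1]]. *)
Lemma has_der_cint (K K' : R -> R -> R) (u v C a : R) :
  u < a < v ->
  (forall s, u < s < v -> continuous (K s)) ->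
  (forall s t : R, u < s < v -> has_der s (K^~ t) (K' s t)) ->
  (forall s t, u < s < v -> `|K' s t| <= C) ->
  has_der a (fun s => cint (K s)) (cint (K' a)).
Proof.
move=> auv cK dK bK.
have d1 s t : u < s < v -> partial1of2 K s t = K' s t.
  by move=> suv; rewrite partial1of2E; have [_ ->] := dK s t suv.
have Ia : `]u, v[%classic a by rewrite /= in_itv.
have I1 x : `]u, v[%classic x -> mu.-integrable `[0, 2 * pi] (EFin \o K x).
  by rewrite /= in_itv/= => xuv; exact: cint_integrable (cK _ xuv).
have I2 x y : `]u, v[%classic x -> `[0, 2 * pi]%classic y -> derivable (K^~ y) x 1.
  by rewrite /= in_itv/= => xuv _; have [] := dK x y xuv.
have C0 : forall t : R, 0 <= C.
  by move=> t; apply: le_trans (bK a t auv); exact: normr_ge0.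
have I3 : mu.-integrable `[0, 2 * pi] (EFin \o (fun=> C)).
  by apply: cint_integrable => x; exact: cvg_cst.
have I4 x y : `]u, v[%classic x -> `[0, 2 * pi]%classic y ->
    `|partial1of2 K x y| <= C.
  by rewrite /= in_itv/= => xuv _; rewrite d1//; exact: bK.
have mB : measurable (`[0, 2 * pi]%classic : set (measurableTypeR R)) by exact: measurable_itv.
apply: DeriveDef.
  exact: (derivable_under_integral mB Ia I1 I2 C0 I3 I4).
rewrite -derive1E (differentiation_under_integral mB Ia I1 I2 C0 I3 I4).
by apply: eq_cint => t /=; rewrite d1.
Qed.

End circle_integral.

(** * The plane *)

Section plane.
Context {R : realType}.
Local Notation C := (R * R)%type.
Implicit Types p q : C.

(** The norm carried by [R * R] is the maximum of the two absolute values, hence a separate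
    Euclidean norm. *)
Definition cnorm p : R := Num.sqrt (p.1 ^+ 2 + p.2 ^+ 2).

Lemma cdistE p q : cdist p q = cnorm (p - q). Proof. by []. Qed.

Lemma cnorm_ge0 p : 0 <= cnorm p. Proof. exact: sqrtr_ge0. Qed.

Lemma sqr_cnorm p : cnorm p ^+ 2 = p.1 ^+ 2 + p.2 ^+ 2.
Proof. by rewrite sqr_sqrtr// addr_ge0// sqr_ge0. Qed.

Lemma cnormE a b : cnorm (a, b) = Num.sqrt (a ^+ 2 + b ^+ 2). Proof. by []. Qed.

Lemma cnorm0 : cnorm 0 = 0.
Proof. by rewrite /cnorm/= expr0n addr0 sqrtr0. Qed.

Lemma cnormN p : cnorm (- p) = cnorm p.
Proof. by rewrite /cnorm/= !sqrrN. Qed.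

Lemma cdistC p q : cdist p q = cdist q p.
Proof. by rewrite !cdistE -cnormN opprB. Qed.

Lemma cdist0 p : cdist p 0 = cnorm p. Proof. by rewrite cdistE subr0. Qed.

(** Squaring reduces this to Cauchy-Schwarz, which is Lagrange's identity: the defect is the square
    of [p.1 * q.2 - p.2 * q.1]. *)
Lemma cnormD p q : cnorm (p + q) <= cnorm p + cnorm q.
Proof.
rewrite -ler_sqr ?nnegrE ?addr_ge0 ?cnorm_ge0// sqrrD !sqr_cnorm/=.
have : p.1 * q.1 + p.2 * q.2 <= cnorm p * cnorm q.
  apply: le_trans (ler_norm _) _.
  rewrite -ler_sqr ?nnegrE ?mulr_ge0 ?cnorm_ge0// real_normK ?num_real//.
  rewrite exprMn !sqr_cnorm -subr_ge0.
  have -> : (p.1 ^+ 2 + p.2 ^+ 2) * (q.1 ^+ 2 + q.2 ^+ 2) -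
    (p.1 * q.1 + p.2 * q.2) ^+ 2 = (p.1 * q.2 - p.2 * q.1) ^+ 2 by ring.
  exact: sqr_ge0.
nra.
Qed.

Lemma cdist_triangle p q s : cdist p s <= cdist p q + cdist q s.
Proof. by rewrite !cdistE -[p - s](subrKA q); exact: cnormD. Qed.

Lemma cnormZ (s : R) p : cnorm (s *: p) = `|s| * cnorm p.
Proof.
rewrite /cnorm -sqrtr_sqr -sqrtrM ?sqr_ge0//; congr Num.sqrt.
by rewrite /GRing.scale/= /GRing.scale/=; ring.
Qed.

Lemma cnorm_eq0 p : (cnorm p == 0) = (p == 0).
Proof.
rewrite sqrtr_eq0 -[p == 0]/((p.1 == 0) && (p.2 == 0)) le_eqVlt.
rewrite ltNge addr_ge0 ?sqr_ge0//= orbF paddr_eq0 ?sqr_ge0//.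
by rewrite !sqrf_eq0.
Qed.

Lemma normr_fst_le p : `|p.1| <= cnorm p.
Proof.
by rewrite -sqrtr_sqr ler_wsqrtr// lerDl sqr_ge0.
Qed.

Lemma normr_snd_le p : `|p.2| <= cnorm p.
Proof.
by rewrite -sqrtr_sqr ler_wsqrtr// lerDr sqr_ge0.
Qed.

Lemma cnorm_le_sum p : cnorm p <= `|p.1| + `|p.2|.
Proof.
rewrite -ler_sqr ?nnegrE ?addr_ge0 ?cnorm_ge0// sqrrD sqr_cnorm !real_normK ?num_real//.
by rewrite addrAC -addrA lerD2l lerDl mulrn_wge0// mulr_ge0.
Qed.

Definition cmul p q : C := (p.1 * q.1 - p.2 * q.2, p.1 * q.2 + p.2 * q.1).
Definition cinv p : C :=
  (p.1 / (p.1 ^+ 2 + p.2 ^+ 2), - p.2 / (p.1 ^+ 2 + p.2 ^+ 2)).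
Definition cconj p : C := (p.1, - p.2).

Lemma normsq_gt0 p : p != 0 -> 0 < p.1 ^+ 2 + p.2 ^+ 2.
Proof. by rewrite -cnorm_eq0 -sqr_cnorm => p0; rewrite exprn_gt0// lt_def p0 cnorm_ge0. Qed.

Lemma continuous_forI (T U : topologicalType) (f : T -> U) :
  (forall x, {for x, continuous f}) -> continuous f.
Proof. by []. Qed.

Lemma continuous_pair_at (T : topologicalType) (f g : T -> R) x :
  {for x, continuous f} -> {for x, continuous g} ->
  {for x, continuous (fun y => (f y, g y) : C)}.
Proof. by move=> cf cg; apply: (cvg_pair (G := nbhs (f x)) (H := nbhs (g x))). Qed.

Lemma continuous_fst_at (T : topologicalType) (f : T -> C) x :
  {for x, continuous f} -> {for x, continuous (fun y => (f y).1)}.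
Proof. by move=> cf; apply: (@continuous_comp _ _ _ f fst x cf); exact: cvg_fst. Qed.

Lemma continuous_snd_at (T : topologicalType) (f : T -> C) x :
  {for x, continuous f} -> {for x, continuous (fun y => (f y).2)}.
Proof. by move=> cf; apply: (@continuous_comp _ _ _ f snd x cf); exact: cvg_snd. Qed.

Lemma continuous_cmul_at (T : topologicalType) (f g : T -> C) x :
  {for x, continuous f} -> {for x, continuous g} ->
  {for x, continuous (fun y => cmul (f y) (g y))}.
Proof.
move=> cf cg.
have f1 := continuous_fst_at cf; have f2 := continuous_snd_at cf.
have g1 := continuous_fst_at cg; have g2 := continuous_snd_at cg.
apply: continuous_pair_at.
  by apply: continuousB; apply: continuousM.
by apply: continuousD; apply: continuousM.
Qed.

Lemma continuous_cinv_at (T : topologicalType) (f : T -> C) x :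
  f x != 0 -> {for x, continuous f} ->
  {for x, continuous (fun y => cinv (f y))}.
Proof.
move=> fx0 cf.
have f1 := continuous_fst_at cf; have f2 := continuous_snd_at cf.
have c : {for x, continuous (fun y => ((f y).1 ^+ 2 + (f y).2 ^+ 2)^-1)}.
  apply: cvgV; first by rewrite gt_eqF// normsq_gt0.
  by apply: cvgD; exact: cvgM.
apply: continuous_pair_at; apply: continuousM => //.
exact: continuousN.
Qed.

Lemma continuous_cdist (z : C) : continuous (cdist z).
Proof.
move=> w; have c1 : {for w, continuous (fun w : C => z.1 - w.1)}.
  by apply: continuousB; [exact: cst_continuous|exact: cvg_fst].
have c2 : {for w, continuous (fun w : C => z.2 - w.2)}.
  by apply: continuousB; [exact: cst_continuous|exact: cvg_snd].
apply: (@continuous_comp _ _ _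
  (fun w : C => (z.1 - w.1) ^+ 2 + (z.2 - w.2) ^+ 2) Num.sqrt).
  by apply: cvgD; exact: cvgM.
exact: sqrt_continuous.
Qed.

Lemma open_Qdisc (z : C) r : open (Qdisc z r).
Proof.
have -> : Qdisc z r = cdist z @^-1` [set x | x < r].
  by apply/seteqP; split => w; rewrite /Qdisc/= cdistC.
by apply: open_comp; [move=> w _; exact: continuous_cdist|exact: open_lt].
Qed.

Lemma closed_disc (z : C) r : closed [set w | cdist w z <= r].
Proof.
have -> : [set w | cdist w z <= r] = cdist z @^-1` [set x | x <= r].
  by apply/seteqP; split => w; rewrite /= cdistC.
by apply: closed_comp; [move=> w _; exact: continuous_cdist|exact: closed_le].
Qed.

Lemma compact_disc (z : C) r : compact [set w | cdist w z <= r].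
Proof.
apply: (@subclosed_compact _ _ (`[z.1 - r, z.1 + r] `*` `[z.2 - r, z.2 + r])).
- exact: closed_disc.
- by apply: compact_setX; exact: segment_compact.
- move=> w /= h; have := le_trans (normr_fst_le (w - z)) h.
  have := le_trans (normr_snd_le (w - z)) h.
  by rewrite /= !ler_norml !in_itv/= => /andP[? ?] /andP[? ?]; split; lra.
Qed.

Lemma continuous_bounded_disc (z : C) r (f : C -> R) :
  (forall w, cdist w z <= r -> {for w, continuous f}) ->
  exists2 K, 0 <= K & forall w, cdist w z <= r -> `|f w| <= K.
Proof.
move=> cf.
have cD : {within [set w | cdist w z <= r], continuous f}.
  by apply: continuous_in_subspaceT => w; rewrite inE; exact: cf.
have /compact_bounded[M [_ mrt]] := continuous_compact cD (@compact_disc z r).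
exists (Num.max 0 (M + 1)); first by rewrite le_max lexx.
move=> w wr; rewrite le_max; apply/orP; right.
by apply: mrt; [rewrite ltrDl|exists w].
Qed.

End plane.

(** * Holomorphic functions and the Cauchy formula *)

Section holomorphic.
Context {R : realType}.
Local Notation C := (R * R)%type.

(* [g] is the continuous complex derivative of [f] on [D]; differentiability is
   expressed by the chain rule along differentiable paths. *)
Definition holo (D : set C) (f g : C -> C) : Prop := forall p, D p ->
  [/\ {for p, continuous f}, {for p, continuous g} &
   forall (c1 c2 : R -> R) (t x y : R), (c1 t, c2 t) = p ->
     has_der t c1 x -> has_der t c2 y ->
     has_der t (fun s => (f (c1 s, c2 s)).1) (cmul (g p) (x, y)).1 /\
     has_der t (fun s => (f (c1 s, c2 s)).2) (cmul (g p) (x, y)).2].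

Lemma holoS (D E : set C) f g : D `<=` E -> holo E f g -> holo D f g.
Proof. by move=> DE hf p /DE; exact: hf. Qed.

Lemma holo_affine D (a b : C) : holo D (fun p => b + cmul a p) (fun=> a).
Proof.
move=> p _; split.
- apply: continuousD; first exact: cst_continuous.
  apply: continuous_cmul_at; first exact: cst_continuous.
  exact: cvg_id.
- exact: cst_continuous.
- move=> c1 c2 t x y _ d1 d2; split => /=.
  + apply: has_der_val_eq.
      exact: (has_der_addf (has_der_cstf b.1 t) (has_der_subf
        (has_der_mulf (has_der_cstf a.1 t) d1)
        (has_der_mulf (has_der_cstf a.2 t) d2))).
    by ring.
  + apply: has_der_val_eq.
      exact: (has_der_addf (has_der_cstf b.2 t) (has_der_addf
        (has_der_mulf (has_der_cstf a.1 t) d2)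
        (has_der_mulf (has_der_cstf a.2 t) d1))).
    by ring.
Qed.

Lemma holo_cst D (b : C) : holo D (fun=> b) (fun=> 0).
Proof.
move=> p _; split; [exact: cst_continuous|exact: cst_continuous|].
move=> c1 c2 t x y _ d1 d2; split => /=.
- by rewrite !mul0r subr0; exact: has_der_cstf.
- by rewrite !mul0r addr0; exact: has_der_cstf.
Qed.

Lemma holo_id D : holo D id (fun=> (1, 0)).
Proof.
move=> p _; split; [exact: cvg_id|exact: cst_continuous|].
move=> c1 c2 t x y _ d1 d2; split => /=.
- by rewrite !mul0r mul1r subr0.
- by rewrite !mul0r mul1r addr0.
Qed.

Lemma holo_mul D f g f' g' : holo D f f' -> holo D g g' ->
  holo D (fun p => cmul (f p) (g p))
         (fun p => cmul (f' p) (g p) + cmul (f p) (g' p)).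
Proof.
move=> hf hg p Dp.
have [cf cf' df] := hf p Dp; have [cg cg' dg] := hg p Dp; split.
- exact: continuous_cmul_at.
- by apply: continuousD; exact: continuous_cmul_at.
- move=> c1 c2 t x y cp d1 d2.
  have [f1 f2] := df _ _ _ _ _ cp d1 d2.
  have [g1 g2] := dg _ _ _ _ _ cp d1 d2.
  split => /=.
  + apply: has_der_val_eq.
      by apply: has_der_subf; apply: has_der_mulf; eassumption.
    by rewrite /= cp /cmul/=; ring.
  + apply: has_der_val_eq.
      by apply: has_der_addf; apply: has_der_mulf; eassumption.
    by rewrite /= cp /cmul/=; ring.
Qed.

Lemma holo_inv D f f' : (forall p, D p -> f p != 0) -> holo D f f' ->
  holo D (fun p => cinv (f p))
    (fun p => cmul (cmul (- f' p) (cinv (f p))) (cinv (f p))).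
Proof.
move=> f0 hf p Dp; have [cf cf' df] := hf p Dp.
have ci := continuous_cinv_at (f0 p Dp) cf.
have n0 := normsq_gt0 (f0 p Dp).
split => //.
- apply: continuous_cmul_at => //; apply: continuous_cmul_at => //.
  exact: continuousN.
- move=> c1 c2 t x y cp d1 d2.
  have [f1 f2] := df _ _ _ _ _ cp d1 d2.
  have dn := has_der_addf (has_der_mulf f1 f1) (has_der_mulf f2 f2).
  have {}dn := (fun nz => has_der_invf nz dn).
  have nz : (f (c1 t, c2 t)).1 * (f (c1 t, c2 t)).1 +
      (f (c1 t, c2 t)).2 * (f (c1 t, c2 t)).2 != 0.
    by rewrite cp -!expr2 gt_eqF.
  have {}dn := dn nz.
  split => /=.
  + apply: has_der_val_eq; first exact: (has_der_mulf f1 dn).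
    rewrite /= !cp /cmul/=; field.
    by rewrite -?expr2 gt_eqF.
  + apply: has_der_val_eq; first exact: (has_der_mulf (has_der_oppf f2) dn).
    rewrite /= !cp /cmul/=; field.
    by rewrite -?expr2 gt_eqF.
Qed.

End holomorphic.

(** * The Cauchy integral on a circle *)

Section cauchy.
Context {R : realType}.
Local Notation C := (R * R)%type.

Definition circ (r t : R) : C := (r * cos t, r * sin t).

Lemma circ_normsq (r t : R) : (circ r t).1 ^+ 2 + (circ r t).2 ^+ 2 = r ^+ 2.
Proof. by rewrite /= !exprMn -mulrDr cos2Dsin2 mulr1. Qed.

Lemma cnorm_circ (r t : R) : 0 <= r -> cnorm (circ r t) = r.
Proof. by move=> r0; rewrite /cnorm circ_normsq sqrtr_sqr ger0_norm. Qed.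

Lemma has_der_circ1 (r t : R) :
  has_der t (fun t => (circ r t).1) (- (circ r t).2).
Proof.
apply: has_der_val_eq; first by
  apply: has_der_mulf; [exact: has_der_cstf|exact: is_derive_cos].
by rewrite /= mulr0 addr0 mulrN.
Qed.

Lemma has_der_circ2 (r t : R) :
  has_der t (fun t => (circ r t).2) ((circ r t).1).
Proof.
apply: has_der_val_eq; first by
  apply: has_der_mulf; [exact: has_der_cstf|exact: is_derive_sin].
by rewrite /= mulr0 addr0.
Qed.

Lemma continuous_circ (r : R) : continuous (circ r).
Proof.
move=> t; apply: (@continuous_pair_at _ _ (fun t => r * cos t) (fun t => r * sin t));
  apply: continuousM.
- exact: cst_continuous.
- exact: continuous_cos.
- exact: cst_continuous.
- exact: continuous_sin.
Qed.

(** With [zeta = circ r t] one has [d zeta = i zeta dt], so this is the Cauchy kernel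
    [d zeta / (zeta - z)] written in the angle, up to the factor [i]. *)
Definition cker (r : R) (z : C) (t : R) : C :=
  cmul (circ r t) (cinv (circ r t - z)).

Lemma circ_neq (r t : R) (z : C) : 0 < r -> cnorm z < r -> circ r t - z != 0.
Proof.
move=> r0 zr; apply/eqP => /subr0_eq e.
by move: zr; rewrite -e cnorm_circ ?ltxx// ltW.
Qed.

Lemma continuous_cinv_circ (r : R) z : 0 < r -> cnorm z < r ->
  continuous (fun t => cinv (circ r t - z)).
Proof.
move=> r0 zr; apply: continuous_forI => t; apply: continuous_cinv_at; first exact: circ_neq.
by apply: continuousB; [exact: continuous_circ|exact: cst_continuous].
Qed.

Lemma continuous_cker (r : R) z : 0 < r -> cnorm z < r -> continuous (cker r z).
Proof.
move=> r0 zr; apply: continuous_forI => t; apply: continuous_cmul_at; first exact: continuous_circ.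
exact: continuous_cinv_circ.
Qed.

Lemma cint_circ (r : R) : cint (fun t => (circ r t).1) = 0 /\
  cint (fun t => (circ r t).2) = 0.
Proof.
have c1 : continuous (fun t => (circ r t).1).
  by apply: continuous_forI => t; apply: continuous_fst_at; exact: continuous_circ.
have c2 : continuous (fun t => (circ r t).2).
  by apply: continuous_forI => t; apply: continuous_snd_at; exact: continuous_circ.
split.
  rewrite (cint_derive (has_der_circ2 r) c1)/= sin0.
  by rewrite mulr_natl sin2pi subrr.
rewrite (@cint_derive _ (fun t => - (circ r t).1)) => [|t|] //.
  by rewrite /= mulr_natl cos2pi cos0 subrr.
apply: has_der_val_eq; first by apply: has_der_oppf; exact: has_der_circ1.
by rewrite opprK.
Qed.

(* The homotopy [s |-> z + s (w - z)] contracts the circle to [z]; the Cauchy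
   integral along it has zero derivative in [s], since the integrand is then an
   exact derivative in the angle. *)
Lemma cauchy_homotopy (rho r : R) (f g : C -> C) (z : C) :
  0 < r -> r < rho -> cnorm z < r -> holo (Qdisc 0 rho) f g ->
  cint (fun t => (cmul (f (circ r t)) (cker r z t)).1) =
  (cmul (f z) (cint (fun t => (cker r z t).1), cint (fun t => (cker r z t).2))).1.
Proof.
move=> r0 rrho zr hf.
(* [ka] lets [s] range over a neighbourhood of [[0, 1]] while the contracted circle stays in the
   closed disc of radius [(rho + r) / 2 < rho], on which [g] is bounded. *)
pose ka := (rho - r) / (4 * r).
have ka0 : 0 < ka by rewrite divr_gt0 ?mulr_gt0// subr_gt0.
have kaE : (1 + 2 * ka) * r = (rho + r) / 2.
  by rewrite /ka; field; rewrite gt_eqF.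
pose c1 t s : R := z.1 + s * ((circ r t).1 - z.1).
pose c2 t s : R := z.2 + s * ((circ r t).2 - z.2).
have cE t s : (c1 t s, c2 t s) = z + s *: (circ r t - z) by [].
have cn t s : - ka < s < 1 + ka -> cnorm (c1 t s, c2 t s) <= (rho + r) / 2.
  move=> /andP[s1 s2].
  have -> : (c1 t s, c2 t s) = (1 - s) *: z + s *: circ r t.
    transitivity ((1 - s) * z.1 + s * (circ r t).1,
      (1 - s) * z.2 + s * (circ r t).2); last by [].
    by congr pair; rewrite /c1 /c2; ring.
  apply: le_trans (cnormD _ _) _; rewrite !cnormZ cnorm_circ; last exact: ltW.
  have z0 := cnorm_ge0 z.
  apply: (@le_trans _ _ (`|1 - s| * r + `|s| * r)).
    by rewrite lerD2r ler_wpM2l// ltW.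
  rewrite -kaE -mulrDl ler_wpM2r//; first exact: ltW.
  by case: (ger0P (1 - s)) => ?; case: (ger0P s) => ?; lra.
have cD t s : - ka < s < 1 + ka -> Qdisc 0 rho (c1 t s, c2 t s).
  move=> h; rewrite /Qdisc/= cdist0; apply: le_lt_trans (cn _ _ h) _; lra.
have [K1 K10 bK1] := @continuous_bounded_disc R 0 ((rho + r) / 2) (fun p => (g p).1)
  (fun p pr => continuous_fst_at (let: And3 _ c _ := hf p
    (le_lt_trans pr (ltac:(lra) : (rho + r) / 2 < rho)) in c)).
have [K2 K20 bK2] := @continuous_bounded_disc R 0 ((rho + r) / 2) (fun p => (g p).2)
  (fun p pr => continuous_snd_at (let: And3 _ c _ := hf p
    (le_lt_trans pr (ltac:(lra) : (rho + r) / 2 < rho)) in c)).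
pose K s t := (cmul (f (c1 t s, c2 t s)) (cker r z t)).1.
pose K' s t := (cmul (g (c1 t s, c2 t s)) (circ r t)).1.
have cc s : continuous (fun t => (c1 t s, c2 t s)).
  apply: continuous_forI => t; apply: continuous_pair_at; apply: continuousD;
    try exact: cst_continuous; apply: continuousM;
    try exact: cst_continuous; apply: continuousB;
    try exact: cst_continuous.
  + by apply: continuous_fst_at; exact: continuous_circ.
  + by apply: continuous_snd_at; exact: continuous_circ.
have cfc s t : - ka < s < 1 + ka ->
    {for t, continuous (fun t => f (c1 t s, c2 t s))}.
  move=> h; apply: (@continuous_comp _ _ _ (fun t => (c1 t s, c2 t s)) f).
    exact: cc.
  by have [] := hf _ (cD t s h).
have cgc s t : - ka < s < 1 + ka ->
    {for t, continuous (fun t => g (c1 t s, c2 t s))}.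
  move=> h; apply: (@continuous_comp _ _ _ (fun t => (c1 t s, c2 t s)) g).
    exact: cc.
  by have [] := hf _ (cD t s h).
have cK s : - ka < s < 1 + ka -> continuous (K s).
  move=> h; apply: continuous_forI => t; apply: continuous_fst_at; apply: continuous_cmul_at.
    exact: cfc.
  exact: continuous_cker.
have cK' s : - ka < s < 1 + ka -> continuous (K' s).
  move=> h; apply: continuous_forI => t; apply: continuous_fst_at; apply: continuous_cmul_at.
    exact: cgc.
  exact: continuous_circ.
(* The velocity of the homotopy in [s] is [circ r t - z], which cancels the pole: [K'] is the real
   part of [g] times [circ r t]. *)
have ckE t : cmul (circ r t - z) (cker r z t) = circ r t.
  have := normsq_gt0 (circ_neq t r0 zr).
  rewrite /cker /cmul /cinv/= => h.
  by congr pair; field; rewrite gt_eqF.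
have dK s t : - ka < s < 1 + ka -> has_der s (K^~ t) (K' s t).
  move=> h; have [_ _ df] := hf _ (cD t s h).
  have d1 : has_der s (c1 t) ((circ r t - z).1).
    apply: has_der_val_eq.
      apply: has_der_addf; first exact: has_der_cstf.
      by apply: has_der_mulf; [exact: has_der_idf|exact: has_der_cstf].
    by rewrite mulr0 !add0r mulr1.
  have d2 : has_der s (c2 t) ((circ r t - z).2).
    apply: has_der_val_eq.
      apply: has_der_addf; first exact: has_der_cstf.
      by apply: has_der_mulf; [exact: has_der_idf|exact: has_der_cstf].
    by rewrite mulr0 !add0r mulr1.
  have [f1 f2] := df _ _ _ _ _ erefl d1 d2.
  apply: has_der_val_eq.
    by apply: has_der_subf; apply: has_der_mulf;
      [exact: f1|exact: has_der_cstf|exact: f2|exact: has_der_cstf].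
  have -> : K' s t =
      (cmul (g (c1 t s, c2 t s)) (cmul (circ r t - z) (cker r z t))).1.
    by rewrite /K' ckE.
  move: (cker r z t) (circ r t - z) => k d.
  by rewrite /cmul/=; ring.
have bK' s t : - ka < s < 1 + ka -> `|K' s t| <= K1 * r + K2 * r.
  move=> h; rewrite /K' /cmul/=.
  apply: le_trans (ler_normB _ _) _; rewrite !normrM.
  have := normr_fst_le (circ r t); have := normr_snd_le (circ r t).
  rewrite cnorm_circ; last exact: ltW.
  rewrite /= !normrM => b2 b1.
  apply: lerD; apply: ler_pM => //.
    by apply: bK1; rewrite cdist0; exact: cn.
  by apply: bK2; rewrite cdist0; exact: cn.
have dphi s : - ka < s < 1 + ka -> has_der s (fun s => cint (K s)) 0.
  move=> h; have <- : cint (K' s) = 0.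
    (* The primitive used for [s != 0] divides by [s]. At [s = 0] the integrand is the real part of
       [g z] times [circ r t], whose mean vanishes. *)
    have [s0|s0] := eqVneq s 0.
      have cz t : (c1 t s, c2 t s) = z.
        by rewrite s0 /c1 /c2 !mul0r !addr0 -surjective_pairing.
      rewrite (@eq_cint _ _ (fun t => (g z).1 * (circ r t).1 - (g z).2 * (circ r t).2)).
        have [i1 i2] := cint_circ r.
        have k1 : continuous (fun t => (circ r t).1).
          by apply: continuous_forI => t; apply: continuous_fst_at; exact: continuous_circ.
        have k2 : continuous (fun t => (circ r t).2).
          by apply: continuous_forI => t; apply: continuous_snd_at; exact: continuous_circ.
        by rewrite (cint_lin _ _ k1 k2) i1 i2 !mulr0 subr0.
      by move=> t; rewrite /K' cz.
    (* The loop has angular velocity [i s zeta], so the imaginary part of [f] along it has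
       derivative [s * K' s t]; it takes the same value at both ends. *)
    rewrite (@cint_derive _ (fun t => s^-1 * (f (c1 t s, c2 t s)).2)).
    - rewrite /c1 /c2 /=; rewrite cos0 sin0 mulr_natl cos2pi sin2pi.
      by rewrite subrr.
    - move=> t; have [_ _ df] := hf _ (cD t s h).
      have d1 : has_der t (c1 ^~ s) (- (s * (circ r t).2)).
        apply: has_der_val_eq.
          apply: has_der_addf; first exact: has_der_cstf.
          apply: has_der_mulf; first exact: has_der_cstf.
          by apply: has_der_subf; [exact: has_der_circ1|exact: has_der_cstf].
        by rewrite /=; ring.
      have d2 : has_der t (c2 ^~ s) (s * (circ r t).1).
        apply: has_der_val_eq.
          apply: has_der_addf; first exact: has_der_cstf.
          apply: has_der_mulf; first exact: has_der_cstf.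
          by apply: has_der_subf; [exact: has_der_circ2|exact: has_der_cstf].
        by rewrite /=; ring.
      have [_ f2] := df (c1 ^~ s) (c2 ^~ s) t _ _ erefl d1 d2.
      apply: has_der_val_eq.
        by apply: has_der_mulf; [exact: has_der_cstf|exact: f2].
      by rewrite /K' /cmul/=; field.
    - exact: cK'.
  exact: (has_der_cint h cK dK bK').
have := derive0_eq dphi (_ : - ka < 1 < 1 + ka) (_ : - ka < 0 < 1 + ka).
have -> : - ka < 1 < 1 + ka by lra.
have -> : - ka < 0 < 1 + ka by lra.
move=> /(_ isT isT) H.
transitivity (cint (K 1)).
  apply: eq_cint => t; rewrite /K; congr (cmul (f _) _).1.
  by rewrite cE scale1r addrC subrK.
have k1 : continuous (fun t => (cker r z t).1).
  by apply: continuous_forI => t; apply: continuous_fst_at; exact: continuous_cker.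
have k2 : continuous (fun t => (cker r z t).2).
  by apply: continuous_forI => t; apply: continuous_snd_at; exact: continuous_cker.
rewrite H (@eq_cint _ _ (fun t => (f z).1 * (cker r z t).1 - (f z).2 * (cker r z t).2)).
  by rewrite (cint_lin _ _ k1 k2).
by move=> t; rewrite /K cE scale0r addr0.
Qed.

(** The case [z = 0] of [cauchy_homotopy], where the kernel is identically 1. *)
Lemma mean_value1 (rho r : R) f g : 0 < r -> r < rho ->
  holo (Qdisc 0 rho) f g ->
  cint (fun t => (f (circ r t)).1) = (f 0).1 * (2 * pi).
Proof.
move=> r0 rrho hf.
have k t : cker r 0 t = (1, 0).
  rewrite /cker subr0 /cmul /cinv circ_normsq/=; congr pair; last by ring.
  have := circ_normsq r t => /= e.
  have -> : r * cos t * (r * cos t / r ^+ 2) - r * sin t * (- (r * sin t) / r ^+ 2) =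
    ((r * cos t) ^+ 2 + (r * sin t) ^+ 2) / r ^+ 2 by ring.
  by rewrite e divff// expf_neq0// gt_eqF.
have := cauchy_homotopy r0 rrho (_ : cnorm 0 < r) hf.
rewrite cnorm0 r0 => /(_ isT).
rewrite (eq_cint (_ : _ =1 (fun t => (f (circ r t)).1))); last first.
  by move=> t; rewrite k /cmul/= mulr1 mulr0 subr0.
move=> ->.
have -> : (fun t => (cker r 0 t).1) = fun=> 1 by apply/funext => t; rewrite k.
have -> : (fun t => (cker r 0 t).2) = fun=> 0 by apply/funext => t; rewrite k.
by rewrite !cint_cst /cmul/= mul0r mulr0 subr0 mul1r.
Qed.

(** Multiplication by [- i] turns the imaginary part into the real part. *)
Lemma mean_value2 (rho r : R) f g : 0 < r -> r < rho ->
  holo (Qdisc 0 rho) f g ->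
  cint (fun t => (f (circ r t)).2) = (f 0).2 * (2 * pi).
Proof.
move=> r0 rrho hf.
have := mean_value1 r0 rrho (holo_mul (@holo_cst _ _ (0, -1)) hf).
rewrite /cmul/= mul0r sub0r mulN1r opprK => <-.
by apply: eq_cint => t; rewrite mul0r sub0r mulN1r opprK.
Qed.

End cauchy.

(** * Single layer representation *)

Section neumann.
Context {R : realType}.
Local Notation C := (R * R)%type.
Implicit Types p q z a : C.

Lemma cnorm_mul p q : cnorm (cmul p q) = cnorm p * cnorm q.
Proof.
by rewrite /cnorm -sqrtrM ?addr_ge0 ?sqr_ge0//; congr Num.sqrt; rewrite /cmul/=; ring.
Qed.

Lemma cnorm_inv p : p != 0 -> cnorm (cinv p) = (cnorm p)^-1.
Proof.
move=> p0; have n0 := normsq_gt0 p0.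
rewrite /cnorm -sqrtrV ?ltW//; congr Num.sqrt; rewrite /cinv/=.
by field; rewrite gt_eqF.
Qed.

(* [r^2 - conj z * p], whose inverse has its pole at the reflection of [z] in
   the circle of radius [r]. *)
Definition refl (r : R) z p : C := (r ^+ 2, 0) + cmul (- cconj z) p.

(** On the circle [r^2 = zeta * conj zeta], hence [refl r z zeta = zeta * conj (zeta - z)]. The
    conjugate of [1 / (zeta - z)] thus extends holomorphically into the disc. *)
Lemma refl_circ (r t : R) z : 0 < r -> cnorm z < r ->
  cmul (circ r t) (cinv (refl r z (circ r t))) = cconj (cinv (circ r t - z)).
Proof.
case: z => a b r0 zr.
have n0 := normsq_gt0 (circ_neq t r0 zr).
have := circ_normsq r t.
rewrite /refl /cinv /cconj /cmul/=; move: n0 => /=.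
set u := r * cos t; set v := r * sin t => n0 e.
rewrite -e /=.
have -> : (u ^+ 2 + v ^+ 2 + (- a * u - - - b * v)) ^+ 2 +
  (0 + (- a * v + - - b * u)) ^+ 2 =
  (u ^+ 2 + v ^+ 2) * ((u - a) ^+ 2 + (v - b) ^+ 2) by ring.
have n1 : 0 < u ^+ 2 + v ^+ 2 by rewrite e exprn_gt0.
by congr pair; field; rewrite !gt_eqF.
Qed.

(** The reflected pole has modulus [r^2 / |z| > r]. The midpoint [m] of [|z|] and [r] replaces
    [|z|], which may be zero. *)
Lemma refl_radius (r rho : R) z : 0 < r -> r < rho -> cnorm z < r ->
  exists2 rho', r < rho' <= rho &
    forall p, Qdisc 0 rho' p -> refl r z p != 0.
Proof.
move=> r0 rrho zr; have z0 := cnorm_ge0 z.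
pose m := (cnorm z + r) / 2.
have m0 : 0 < m by rewrite /m; lra.
have mr : m < r by rewrite /m; lra.
have zm : cnorm z <= m by rewrite /m; lra.
exists (Num.min rho (r ^+ 2 / m)).
  rewrite ge_min lexx lt_min rrho/= andbT ltr_pdivlMr// expr2 ltr_pM2l//.
move=> p; rewrite /Qdisc/= cdist0 lt_min => /andP[_].
rewrite ltr_pdivlMr// => pm; apply/eqP => e.
have : cnorm (cmul (- cconj z) p) = r ^+ 2.
  have -> : cmul (- cconj z) p = - (r ^+ 2, 0).
    by move: e; rewrite /refl => /eqP; rewrite addrC addr_eq0 => /eqP.
  by rewrite cnormN cnormE expr0n addr0 sqrtr_sqr ger0_norm// sqr_ge0.
rewrite cnorm_mul cnormN; have -> : cnorm (cconj z) = cnorm z.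
  by rewrite /cnorm/= sqrrN.
move=> e2; have p0 := cnorm_ge0 p; nra.
Qed.

Lemma holo_refl (r : R) z D :
  (forall p, D p -> refl r z p != 0) ->
  exists g, holo D (fun p => cinv (refl r z p)) g.
Proof. by move=> r0; eexists; apply: holo_inv r0 _; exact: holo_affine. Qed.

(** These are the integrals that [cauchy_homotopy] leaves undetermined. On the circle the kernel is
    [r^2] times the conjugate of [1 / refl r z], a holomorphic function with value [r^-2] at 0, so
    its mean is 1. *)
Lemma cint_cker (r : R) z : 0 < r -> cnorm z < r ->
  cint (fun t => (cker r z t).1) = 2 * pi /\ cint (fun t => (cker r z t).2) = 0.
Proof.
move=> r0 zr.
have r1 : r < r + 1 by rewrite ltrDl.
have [rho' /andP[rr' _] nz] := refl_radius r0 r1 zr.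
have [g hg] := holo_refl nz.
have m1 := mean_value1 r0 rr' hg; have m2 := mean_value2 r0 rr' hg.
have cX : continuous (fun t => cinv (refl r z (circ r t))).
  apply: continuous_forI => t.
  apply: (@continuous_comp _ _ _ (circ r) (fun p => cinv (refl r z p))).
    exact: continuous_circ.
  have [] // := hg (circ r t) _.
  by rewrite /Qdisc/= cdist0 cnorm_circ// ltW.
have kE t : cker r z t = r ^+ 2 *: cconj (cinv (refl r z (circ r t))).
  have e := refl_circ t r0 zr.
  have e1 := circ_normsq r t.
  transitivity (cmul (circ r t) (cconj (cconj (cinv (circ r t - z))))).
    by rewrite /cker; congr cmul; rewrite /cconj/= opprK.
  rewrite -e -e1.
  move: (circ r t) (cinv _) => w X.
  transitivity ((w.1 ^+ 2 + w.2 ^+ 2) * X.1, (w.1 ^+ 2 + w.2 ^+ 2) * - X.2).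
    by rewrite /cmul /cconj/=; congr pair; ring.
  by [].
have R0 : refl r z 0 = (r ^+ 2, 0).
  by rewrite /refl /cmul/= !mulr0 subr0 addr0 -[X in _ + X]/(0 : C) addr0.
split.
  rewrite (@eq_cint _ _ (fun t => r ^+ 2 * (cinv (refl r z (circ r t))).1)).
    rewrite cintZ; last first.
      by apply: continuous_forI => t; apply: continuous_fst_at; exact: cX.
    rewrite m1 R0 /cinv/= expr0n addr0; field.
    by rewrite gt_eqF.
  by move=> t; rewrite kE.
rewrite (@eq_cint _ _ (fun t => - r ^+ 2 * (cinv (refl r z (circ r t))).2)).
  rewrite cintZ; last first.
    by apply: continuous_forI => t; apply: continuous_snd_at; exact: cX.
  by rewrite m2 R0 /cinv/= oppr0 !mul0r mulr0.
by move=> t; rewrite kE mulNr -mulrN.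
Qed.

(** With [X = zeta f] and [Y = a / (zeta - z)], the product [Re X * Re Y] is half of
    [Re (X Y) + Re (X conj Y)]. The first term is a Cauchy integral and gives [2 pi Re (a f z)]. By
    [refl_circ], the second is the real part of a holomorphic function vanishing at 0 and has mean
    zero. *)
Lemma neumann_kernel (rho r : R) f g z a : 0 < r -> r < rho -> cnorm z < r ->
  holo (Qdisc 0 rho) f g ->
  cint (fun t => (cmul (circ r t) (f (circ r t))).1 *
                 (cmul a (cinv (circ r t - z))).1) = pi * (cmul (f z) a).1.
Proof.
move=> r0 rrho zr hf.
have [rho' /andP[rr' rho'r] nz] := refl_radius r0 rrho zr.
have hf' : holo (Qdisc 0 rho') f g.
  by apply: holoS hf => p; rewrite /Qdisc/= => /lt_le_trans; apply.
have [gr hr] := holo_refl nz.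
have hF := holo_mul (holo_mul (holo_mul (@holo_id _ _) (@holo_id _ _))
  (holo_mul (@holo_cst _ _ (cconj a)) hf')) hr.
(* The holomorphic extension of [X conj Y]: one factor [p] comes from [X], the other from
   [refl_circ]. *)
pose F2 p := cmul (cmul (cmul p p) (cmul (cconj a) (f p))) (cinv (refl r z p)).
have mF : cint (fun t => (F2 (circ r t)).1) = 0.
  rewrite (mean_value1 r0 rr' hF) (_ : _.1 = 0) ?mul0r//.
  by rewrite /cmul/=; ring.
have hA := holo_mul (@holo_cst _ _ a) hf'.
have mA := cauchy_homotopy r0 rr' zr hA; move: mA.
have [-> ->] := cint_cker r0 zr.
have wD t : Qdisc 0 rho' (circ r t).
  by rewrite /Qdisc/= cdist0 cnorm_circ// ltW.
have c1 : continuous (fun t => (F2 (circ r t)).1).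
  apply: continuous_forI => t; apply: continuous_fst_at.
  apply: (@continuous_comp _ _ _ (circ r) F2); first exact: continuous_circ.
  by have [] := hF _ (wD t).
have c2 : continuous
    (fun t => (cmul (cmul a (f (circ r t))) (cker r z t)).1).
  apply: continuous_forI => t; apply: continuous_fst_at.
  apply: continuous_cmul_at; last exact: continuous_cker.
  apply: (@continuous_comp _ _ _ (circ r) (fun p => cmul a (f p))).
    exact: continuous_circ.
  by have [] := hA _ (wD t).
rewrite (@eq_cint _ (fun t => (cmul (circ r t) (f (circ r t))).1 * _)
  (fun t => 2^-1 * (cmul (cmul a (f (circ r t))) (cker r z t)).1 -
            (- 2^-1) * (F2 (circ r t)).1)); last first.
  move=> t.
  have -> : F2 (circ r t) = cmul (cmul (cmul (circ r t) (f (circ r t))) (cconj a))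
      (cconj (cinv (circ r t - z))).
    rewrite -refl_circ// /F2; move: (circ r t) (f _) (cinv _) => w fw X.
    by rewrite /cmul/=; congr pair; ring.
  rewrite /cker; move: (circ r t) (f _) (cinv _) => w fw X.
  by rewrite /cmul /cconj/=; field.
rewrite cint_lin// => ->; rewrite mF /cmul/=.
by field.
Qed.

(** For [f = u_x - i u_y], the real part of [zeta f zeta] is [r] times the radial derivative of
    [u]. *)
Definition ndens (r : R) (f : C -> C) (t : R) : R :=
  - pi^-1 * (cmul (circ r t) (f (circ r t))).1.

Lemma ndens_bound (r : R) f (K : R) t : 0 < r -> cnorm (f (circ r t)) <= K ->
  `|ndens r f t| <= pi^-1 * (r * K).
Proof.
have pi0 : 0 <= pi^-1 :> R by rewrite invr_ge0 pi_ge0.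
move=> r0 fK; rewrite /ndens normrM normrN (ger0_norm pi0).
apply: ler_wpM2l => //.
apply: le_trans (normr_fst_le _) _; rewrite cnorm_mul cnorm_circ; last exact: ltW.
by rewrite ler_wpM2l// ltW.
Qed.

Lemma continuous_ndens (r rho : R) f g : 0 < r -> r < rho ->
  holo (Qdisc 0 rho) f g -> continuous (ndens r f).
Proof.
move=> r0 rrho hf; apply: continuous_forI => t.
apply: continuousM; first exact: cst_continuous.
apply: continuous_fst_at; apply: continuous_cmul_at.
  exact: continuous_circ.
apply: (@continuous_comp _ _ _ (circ r) f); first exact: continuous_circ.
have [] // := hf (circ r t) _.
by rewrite /Qdisc/= cdist0 cnorm_circ// ltW.
Qed.

(* A harmonic function in the disc is, up to a constant, the logarithmic
   potential of its (rescaled) normal derivative on the circle: both sides have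
   the same radial derivative by [neumann_kernel]. *)
Lemma single_layer (rho r : R) (f g : C -> C) (h : C -> R) z :
  0 < r -> r < rho -> cnorm z < r -> holo (Qdisc 0 rho) f g ->
  (forall p, Qdisc 0 rho p -> forall (c1 c2 : R -> R) (t x y : R),
     (c1 t, c2 t) = p -> has_der t c1 x -> has_der t c2 y ->
     has_der t (fun s => h (c1 s, c2 s)) (cmul (f p) (x, y)).1) ->
  h z = h 0 + cint (fun t => ndens r f t * ln (cdist z (circ r t))).
Proof.
move=> r0 rrho zr hf hh; have z0 := cnorm_ge0 z.
pose m := (cnorm z + r) / 2.
have mr : m < r by rewrite /m; lra.
(* For [s] slightly beyond [[0, 1]] the point [s z] keeps the distance [r - m] from the circle,
   which bounds the derivative of the logarithm uniformly. *)
pose ka := (r - cnorm z) / (2 * r).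
have ka0 : 0 < ka by rewrite divr_gt0 ?mulr_gt0// subr_gt0.
have kaE : cnorm z + ka * r = m by rewrite /ka /m; field; rewrite gt_eqF.
pose sz (s : R) : C := (s * z.1, s * z.2).
have szn s : - ka < s < 1 + ka -> cnorm (sz s) <= m.
  move=> /andP[s1 s2]; have -> : cnorm (sz s) = `|s| * cnorm z by exact: cnormZ.
  have s3 : `|s| <= 1 + ka by rewrite ler_norml; lra.
  apply: le_trans (ler_wpM2r z0 s3) _.
  by rewrite -kaE mulrDl mul1r lerD2l ler_wpM2l// ltW.
have szr s : - ka < s < 1 + ka -> cnorm (sz s) < r.
  by move=> /szn h1; exact: le_lt_trans mr.
pose n2 s t := ((sz s).1 - (circ r t).1) * ((sz s).1 - (circ r t).1) +
               ((sz s).2 - (circ r t).2) * ((sz s).2 - (circ r t).2).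
have n2E s t : n2 s t = (circ r t - sz s).1 ^+ 2 + (circ r t - sz s).2 ^+ 2.
  by rewrite /n2 /=; ring.
have n20 s t : - ka < s < 1 + ka -> 0 < n2 s t.
  by move=> h1; rewrite n2E; apply: normsq_gt0; exact: circ_neq (szr _ h1).
(* Half the logarithm of the squared distance has a derivative that is rational in the coordinates,
   with no square root. *)
pose K s t := ndens r f t * (2^-1 * ln (n2 s t)).
pose K' s t := ndens r f t * - (cmul z (cinv (circ r t - sz s))).1.
have lnE s t : - ka < s < 1 + ka -> 2^-1 * ln (n2 s t) = ln (cdist (sz s) (circ r t)).
  move=> h1; have : 0 < cnorm (circ r t - sz s).
    by rewrite lt_def cnorm_ge0 cnorm_eq0 circ_neq// szr.
  rewrite cdistC cdistE n2E -sqr_cnorm => h2.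
  by rewrite lnXn// mulr2n; field.
have cn : continuous (ndens r f) by exact: continuous_ndens hf.
have cK s : - ka < s < 1 + ka -> continuous (K s).
  move=> h1; apply: continuous_forI => t; apply: continuousM; first exact: cn.
  apply: continuousM; first exact: cst_continuous.
  apply: (@continuous_comp _ _ _ (n2 s) (@ln R)).
    have k1 := continuous_fst_at (@continuous_circ _ r t).
    have k2 := continuous_snd_at (@continuous_circ _ r t).
    have a1 : {for t, continuous (fun t => (sz s).1 - (circ r t).1)}.
      by apply: continuousB; [exact: cst_continuous|exact: k1].
    have a2 : {for t, continuous (fun t => (sz s).2 - (circ r t).2)}.
      by apply: continuousB; [exact: cst_continuous|exact: k2].
    by apply: continuousD; [exact: (continuousM a1 a1)|exact: (continuousM a2 a2)].
  by apply: continuous_ln; exact: n20.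
have dK s t : - ka < s < 1 + ka -> has_der s (K^~ t) (K' s t).
  move=> h1.
  have d1 : has_der s (fun s => (sz s).1 - (circ r t).1) z.1.
    apply: has_der_val_eq.
      apply: has_der_subf; last exact: has_der_cstf.
      by apply: has_der_mulf; [exact: has_der_idf|exact: has_der_cstf].
    by rewrite /=; ring.
  have d2 : has_der s (fun s => (sz s).2 - (circ r t).2) z.2.
    apply: has_der_val_eq.
      apply: has_der_subf; last exact: has_der_cstf.
      by apply: has_der_mulf; [exact: has_der_idf|exact: has_der_cstf].
    by rewrite /=; ring.
  have dn := has_der_addf (has_der_mulf d1 d1) (has_der_mulf d2 d2).
  have dl : has_der s (fun s => ln (n2 s t)) _ :=
    @is_derive1_comp _ (@ln R) (n2^~ t) s _ _ (is_derive1_ln (n20 s t h1)) dn.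
  apply: has_der_val_eq.
    apply: has_der_mulf; first exact: has_der_cstf.
    by apply: has_der_mulf; [exact: has_der_cstf|exact: dl].
  have eAB : circ r t - sz s =
      (- ((sz s).1 - (circ r t).1), - ((sz s).2 - (circ r t).2)).
    by rewrite !opprB.
  have := n20 s t h1; rewrite /K' eAB /n2.
  move: (ndens r f t) (ln _) => e l.
  move: ((sz s).1 - _) ((sz s).2 - _) => A B n0.
  by rewrite /cmul /cinv/=; field; rewrite !sqrrN !expr2 gt_eqF.
have [K1 K10 bK1] := @continuous_bounded_disc R 0 r (fun p => (f p).1)
  (fun p pr => continuous_fst_at (let: And3 c _ _ := hf p
    (le_lt_trans pr rrho) in c)).
have [K2 K20 bK2] := @continuous_bounded_disc R 0 r (fun p => (f p).2)
  (fun p pr => continuous_snd_at (let: And3 c _ _ := hf p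
    (le_lt_trans pr rrho) in c)).
have bK' s t : - ka < s < 1 + ka ->
    `|K' s t| <= pi^-1 * (r * (K1 + K2)) * (cnorm z * (r - m)^-1).
  move=> h1; rewrite /K' normrM normrN; apply: ler_pM => //.
    apply: ndens_bound => //; apply: le_trans (cnorm_le_sum _) _.
    by apply: lerD; [apply: bK1|apply: bK2];
      rewrite cdist0 cnorm_circ// ltW.
  apply: le_trans (normr_fst_le _) _; rewrite cnorm_mul.
  rewrite cnorm_inv ?circ_neq ?szr//; apply: ler_wpM2l => //.
  have h2 : r - m <= cnorm (circ r t - sz s).
    have := cdist_triangle (circ r t) (sz s) 0.
    rewrite !cdist0 cdistE cnorm_circ; last exact: ltW.
    have := szn s h1; lra.
  by rewrite lef_pV2 ?posrE//; lra.
have dT s : - ka < s < 1 + ka ->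
    has_der s (fun s => h (s * z.1, s * z.2)) (cmul (f (sz s)) z).1.
  move=> h1; have D : Qdisc 0 rho (sz s).
    by rewrite /Qdisc/= cdist0; apply: lt_trans rrho; exact: szr.
  rewrite [X in cmul _ X]surjective_pairing.
  apply: (hh _ D (fun s => s * z.1) (fun s => s * z.2)) => //.
    apply: has_der_val_eq.
      by apply: has_der_mulf; [exact: has_der_idf|exact: has_der_cstf].
    by rewrite /=; ring.
  apply: has_der_val_eq.
    by apply: has_der_mulf; [exact: has_der_idf|exact: has_der_cstf].
  by rewrite /=; ring.
have dE s : - ka < s < 1 + ka ->
    has_der s (fun s => h (s * z.1, s * z.2) - cint (K s)) 0.
  move=> h1; apply: has_der_val_eq.
    apply: has_der_subf; first exact: dT.
    exact: (has_der_cint h1 cK dK bK').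
  (* This is [neumann_kernel] with [a = z]; its factor [pi] cancels the [1 / pi] of the density. *)
  rewrite (@eq_cint _ (K' s) (fun t => pi^-1 *
     ((cmul (circ r t) (f (circ r t))).1 * (cmul z (cinv (circ r t - sz s))).1))).
    rewrite cintZ.
      rewrite (neumann_kernel _ r0 rrho (szr _ h1) hf) mulKf ?subrr//.
      by rewrite gt_eqF// pi_gt0.
    apply: continuous_forI => t; apply: continuousM.
      apply: continuous_fst_at; apply: continuous_cmul_at.
        exact: continuous_circ.
      apply: (@continuous_comp _ _ _ (circ r) f); first exact: continuous_circ.
      have [] // := hf (circ r t) _.
      by rewrite /Qdisc/= cdist0 cnorm_circ// ltW.
    apply: continuous_fst_at; apply: continuous_cmul_at.
      exact: cst_continuous.
    exact: (continuous_cinv_circ r0 (szr _ h1)).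
  by move=> t; rewrite /K' /ndens; ring.
have i1 : - ka < 1 < 1 + ka by lra.
have i0 : - ka < 0 < 1 + ka by lra.
have := derive0_eq dE i1 i0.
(* At the centre the distance to the circle is constantly [r], and [zeta f zeta] has mean zero
   because it vanishes at 0. *)
have -> : cint (K 0) = 0.
  rewrite (@eq_cint _ _ (fun t => (- pi^-1 * ln r) *
     (cmul (circ r t) (f (circ r t))).1)).
    rewrite cintZ.
      rewrite (mean_value1 r0 rrho (holo_mul (@holo_id _ _) hf)).
      by rewrite /cmul/= !mul0r subr0 mul0r mulr0.
    apply: continuous_forI => t.
    apply: continuous_fst_at; apply: continuous_cmul_at.
      exact: continuous_circ.
    apply: (@continuous_comp _ _ _ (circ r) f); first exact: continuous_circ.
    have [] // := hf (circ r t) _.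
    by rewrite /Qdisc/= cdist0 cnorm_circ// ltW.
  move=> t; rewrite /K lnE// /ndens.
  have -> : sz 0 = 0 by rewrite /sz !mul0r.
  by rewrite cdistC cdist0 cnorm_circ ?ltW//; ring.
rewrite !mul1r !mul0r subr0 -surjective_pairing => /(canRL (subrK _)) ->.
congr (_ + _); apply: eq_cint => t; rewrite /K lnE//.
by rewrite /sz !mul1r -surjective_pairing.
Qed.

End neumann.

(** * Harmonic functions *)

Section two_variables.
Context {R : realType}.
Local Notation C := (R * R)%type.
Implicit Types (u : C -> R) (p q : C).

Lemma mvt_slope (v dv : R -> R) (a b l e : R) :
  (forall x, Num.min a b <= x <= Num.max a b ->
     has_der x v (dv x) /\ `|dv x - l| <= e) ->
  `|v b - v a - l * (b - a)| <= e * `|b - a|.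
Proof.
wlog ab : a b / a <= b.
  move=> H; case/orP: (le_total a b) => ab; first exact: H.
  rewrite minC maxC => /(H _ _ ab).
  have -> : v a - v b - l * (a - b) = - (v b - v a - l * (b - a)) by ring.
  by rewrite normrN (distrC a b).
rewrite min_l// max_r// => D.
have [||c] := @MVT_segment R v dv a b ab.
- move=> x; rewrite in_itv/= => /andP[? ?].
  by have [] := D x; first by (apply/andP; split; exact: ltW).
- apply: continuous_in_subspaceT => x; rewrite inE/= in_itv/= => /D[d _].
  exact: has_der_continuous d.
- rewrite in_itv/= => /D[_ de] ->.
  by rewrite -mulrBl normrM ler_wpM2r.
Qed.

Lemma derivable_ex u p : derivable u p ex ->
  has_der p.1 (fun x => u (x, p.2)) (pd ex u p).
Proof.
have E : (fun h : R => h^-1 *: ((u \o shift p) (h *: ex) - u p)) =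
  (fun h => h^-1 *: (((fun x => u (x, p.2)) \o shift p.1) (h *: 1) - u (p.1, p.2))).
  apply/funext => h /=; congr (_ *: (u _ - u _)).
    by rewrite [h *: ex]surjective_pairing /=; congr pair; rewrite /= scaler0 add0r.
  exact: surjective_pairing.
by rewrite /derivable /pd /derive E => d; apply: DeriveDef.
Qed.

Lemma derivable_ey u p : derivable u p ey ->
  has_der p.2 (fun y => u (p.1, y)) (pd ey u p).
Proof.
have E : (fun h : R => h^-1 *: ((u \o shift p) (h *: ey) - u p)) =
  (fun h => h^-1 *: (((fun y => u (p.1, y)) \o shift p.2) (h *: 1) - u (p.1, p.2))).
  apply/funext => h /=; congr (_ *: (u _ - u _)).
    by rewrite [h *: ey]surjective_pairing /=; congr pair; rewrite /= scaler0 add0r.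
  exact: surjective_pairing.
by rewrite /derivable /pd /derive E => d; apply: DeriveDef.
Qed.

Lemma ball_between p d (a b x : R) : `|p.1 - a| < d -> `|p.1 - b| < d ->
  Num.min a b <= x <= Num.max a b -> `|p.1 - x| < d.
Proof.
rewrite !ltr_norml ge_min le_max => ha hb.
by move=> /andP[/orP[] h1 /orP[] h2]; lra.
Qed.

(** Balls of [R * R] are squares, so a horizontal segment with both ends in the ball stays inside
    it, and the estimate is uniform in the height [y]. *)
Lemma slope_ex u p (e : R) : 0 < e ->
  (\forall q \near p, derivable u q ex) -> {for p, continuous (pd ex u)} ->
  exists2 d, 0 < d & forall a b y, `|p.1 - a| < d -> `|p.1 - b| < d ->
    `|p.2 - y| < d ->
    `|u (b, y) - u (a, y) - pd ex u p * (b - a)| <= e * `|b - a|.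
Proof.
move=> e0 du cu.
have /cvgrPdist_lt/(_ e e0) cu' := cu.
have [d /= d0 H] : nbhs_ball p (fun q => derivable u q ex /\ `|pd ex u p - pd ex u q| < e).
  by apply/nbhs_ballP; apply: filterI.
exists d => // a b y ha hb hy.
apply: (@mvt_slope (fun x => u (x, y)) (fun x => pd ex u (x, y))) => x hx.
have hxd : `|p.1 - x| < d by exact: ball_between hx.
have [] := H (x, y) (conj hxd hy) => dx ex; split.
  exact: (derivable_ex dx).
by rewrite distrC ltW.
Qed.

Lemma slope_ey u p (e : R) : 0 < e ->
  (\forall q \near p, derivable u q ey) -> {for p, continuous (pd ey u)} ->
  exists2 d, 0 < d & forall a b x, `|p.2 - a| < d -> `|p.2 - b| < d ->
    `|p.1 - x| < d ->
    `|u (x, b) - u (x, a) - pd ey u p * (b - a)| <= e * `|b - a|.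
Proof.
move=> e0 du cu.
have /cvgrPdist_lt/(_ e e0) cu' := cu.
have [d /= d0 H] : nbhs_ball p (fun q => derivable u q ey /\ `|pd ey u p - pd ey u q| < e).
  by apply/nbhs_ballP; apply: filterI.
exists d => // a b x ha hb hx.
apply: (@mvt_slope (fun y => u (x, y)) (fun y => pd ey u (x, y))) => y hy.
have hyd : `|p.2 - y| < d by exact: (@ball_between (p.2, p.2)) hy.
have [] := H (x, y) (conj hx hyd) => dx ex; split.
  exact: (derivable_ey dx).
by rewrite distrC ltW.
Qed.

(** A slope in the sense of Caratheodory: [l] is filled in where the increment [D] vanishes, which
    may happen along a path arbitrarily close to [t]. *)
Definition quot (D N l : R) : R := if D == 0 then l else N / D.

Lemma quot_le (D N l e : R) : 0 <= e -> `|N - l * D| <= e * `|D| ->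
  `|l - quot D N l| <= e.
Proof.
move=> e0; rewrite /quot; case: eqP => [_|/eqP D0 H]; first by rewrite subrr normr0.
have -> : l - N / D = - (N - l * D) / D by field.
by rewrite normf_div normrN ler_pdivrMr// normr_gt0.
Qed.

(** The increment splits into a horizontal step at height [c2 z] and a vertical step at abscissa
    [c1 t]. The height of the first one moves with [z], which is why the slope estimates are uniform
    in the other variable. *)
Lemma chain_rule2 u p (c1 c2 : R -> R) (t x y : R) :
  (\forall q \near p, derivable u q ex /\ derivable u q ey) ->
  {for p, continuous (pd ex u)} -> {for p, continuous (pd ey u)} ->
  (c1 t, c2 t) = p -> has_der t c1 x -> has_der t c2 y ->
  has_der t (fun s => u (c1 s, c2 s)) (pd ex u p * x + pd ey u p * y).
Proof.
move=> du cx cy cp d1 d2.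
have ct1 := has_der_continuous d1; have ct2 := has_der_continuous d2.
have [g1 [e1 cg1 g1t]] := (is_derive1_caratheodory _ _ _).1 d1.
have [g2 [e2 cg2 g2t]] := (is_derive1_caratheodory _ _ _).1 d2.
pose A z := quot (c1 z - c1 t) (u (c1 z, c2 z) - u (c1 t, c2 z)) (pd ex u p).
pose B z := quot (c2 z - c2 t) (u (c1 t, c2 z) - u (c1 t, c2 t)) (pd ey u p).
have At : A t = pd ex u p by rewrite /A /quot subrr eqxx.
have Bt : B t = pd ey u p by rewrite /B /quot subrr eqxx.
have p1 : p.1 = c1 t by rewrite -cp.
have p2 : p.2 = c2 t by rewrite -cp.
have cA : {for t, continuous A}.
  apply/cvgrPdist_le => /= e e0; rewrite At.
  have [d d0 H] := slope_ex e0 (filterS (fun q => @proj1 _ _) du) cx.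
  have n1 := (cvgrPdist_lt _ _).1 ct1 d d0.
  have n2 := (cvgrPdist_lt _ _).1 ct2 d d0.
  near=> z; apply: quot_le; first exact: ltW.
  apply: H; rewrite ?p1 ?p2 ?subrr ?normr0//; near: z; [exact: n1|exact: n2].
have cB : {for t, continuous B}.
  apply/cvgrPdist_le => /= e e0; rewrite Bt.
  have [d d0 H] := slope_ey e0 (filterS (fun q => @proj2 _ _) du) cy.
  have n2 := (cvgrPdist_lt _ _).1 ct2 d d0.
  near=> z; apply: quot_le; first exact: ltW.
  by apply: H; rewrite ?p1 ?p2 ?subrr ?normr0//; near: z; exact: n2.
apply/is_derive1_caratheodory.
exists (fun z => A z * g1 z + B z * g2 z); split.
- move=> z; rewrite mulrDl -!mulrA -e1 -e2 /A /B /quot.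
  have [a0|a0] := eqVneq (c1 z - c1 t) 0; have [b0|b0] := eqVneq (c2 z - c2 t) 0.
  + by rewrite a0 b0 (subr0_eq a0) (subr0_eq b0) !mulr0 subrr addr0.
  + by rewrite a0 (subr0_eq a0) divfK// mulr0 add0r.
  + by rewrite b0 (subr0_eq b0) divfK// mulr0 addr0.
  + by rewrite !divfK// addrA subrK.
- by apply: continuousD; [exact: (continuousM cA cg1)|exact: (continuousM cB cg2)].
- by rewrite At Bt g1t g2t.
Unshelve. all: by end_near. Qed.

(** Continuity of the partial derivatives bounds the slopes near [p]. The lemma yields continuity of
    the first partial derivatives of a harmonic function, for which [harmonic_on] only asserts
    derivability and continuous derivatives. *)
Lemma C1_continuous u p :
  (\forall q \near p, derivable u q ex /\ derivable u q ey) ->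
  {for p, continuous (pd ex u)} -> {for p, continuous (pd ey u)} ->
  {for p, continuous u}.
Proof.
move=> du cx cy; apply/cvgrPdist_le => /= e e0.
pose m := `|pd ex u p| + 1 + (`|pd ey u p| + 1).
have m0 : 0 < m by apply: addr_gt0; apply: ltr_wpDl.
have [d1 d10 H1] := slope_ex ltr01 (filterS (fun q => @proj1 _ _) du) cx.
have [d2 d20 H2] := slope_ey ltr01 (filterS (fun q => @proj2 _ _) du) cy.
pose d := Num.min (Num.min d1 d2) (e / m).
have d0 : 0 < d by rewrite !lt_min d10 d20/= divr_gt0.
have nb := nbhsx_ballx p d d0.
near=> q.
have [qb1 qb2] : ball p d q by near: q; exact: nb.
have q1 : `|p.1 - q.1| < d by [].
have q2 : `|p.2 - q.2| < d by [].
move: q1 q2; rewrite /d !lt_min => /andP[/andP[q11 q12] q1e] /andP[/andP[q21 q22] q2e].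
have n0 (c b : R) : 0 < b -> `|c - c| < b by rewrite subrr normr0.
have {}H1 := H1 p.1 q.1 q.2 (n0 _ _ d10) q11 q21.
have {}H2 := H2 p.2 q.2 p.1 (n0 _ _ d20) q22 (n0 _ _ d20).
rewrite distrC (surjective_pairing q) [X in _ - u X]surjective_pairing.
have -> : u (q.1, q.2) - u (p.1, p.2) =
  (u (q.1, q.2) - u (p.1, q.2) - pd ex u p * (q.1 - p.1)) +
  pd ex u p * (q.1 - p.1) +
  ((u (p.1, q.2) - u (p.1, p.2) - pd ey u p * (q.2 - p.2)) +
  pd ey u p * (q.2 - p.2)) by ring.
rewrite distrC in q1e; rewrite distrC in q2e.
apply: (@le_trans _ _ (m * (e / m))); last by rewrite mulrC divfK// gt_eqF.
rewrite /m mulrDl; apply: le_trans (ler_normD _ _) _; apply: lerD.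
  apply: le_trans (ler_normD _ _) _; rewrite addrC mulrDl normrM.
  apply: lerD; first by rewrite ler_wpM2l// ltW.
  by apply: le_trans H1 _; rewrite !mul1r ltW.
apply: le_trans (ler_normD _ _) _; rewrite addrC mulrDl normrM.
apply: lerD; first by rewrite ler_wpM2l// ltW.
by apply: le_trans H2 _; rewrite !mul1r ltW.
Unshelve. all: by end_near. Qed.

Lemma second_difference_close (D l l' k e : R) : 0 < k ->
  `|D - l * k * k| <= e / 2 * k * k -> `|D - l' * k * k| <= e / 2 * k * k ->
  `|l - l'| <= e.
Proof.
move=> k0 I1 I2; have kk0 : 0 < k * k by rewrite mulr_gt0.
rewrite -(ler_pM2r kk0) -{1}(gtr0_norm kk0) -normrM.
have -> : (l - l') * (k * k) = (D - l' * k * k) - (D - l * k * k) by ring.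
apply: le_trans (ler_normB _ _) _.
have -> : e * (k * k) = e / 2 * k * k + e / 2 * k * k by field.
exact: lerD.
Qed.

(** Schwarz: the second difference [D] over a square of side [k] is within [e k^2 / 2] of [k^2]
    times either mixed derivative, according to the variable in which the mean value estimate is
    applied first. *)
Lemma mixed_partials u p :
  (\forall q \near p, [/\ derivable u q ex, derivable u q ey,
     derivable (pd ex u) q ey & derivable (pd ey u) q ex]) ->
  {for p, continuous (pd ey (pd ex u))} -> {for p, continuous (pd ex (pd ey u))} ->
  pd ey (pd ex u) p = pd ex (pd ey u) p.
Proof.
move=> du cxy cyx; apply/eqP; rewrite -subr_eq0 -normr_le0; apply/ler_addgt0Pl => e e0.
rewrite addr0; have e2 : 0 < e / 2 by rewrite divr_gt0.
have [d1 d10 H1] := slope_ey e2 (filterS (fun q '(And4 _ _ a _) => a) du) cxy.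
have [d2 d20 H2] := slope_ex e2 (filterS (fun q '(And4 _ _ _ a) => a) du) cyx.
have [d3 /= d30 H3] := (nbhs_ballP _ _).1 du.
pose k := Num.min d1 (Num.min d2 d3) / 2.
have m0 : 0 < Num.min d1 (Num.min d2 d3) by rewrite !lt_min d10 d20 d30.
have k0 : 0 < k by rewrite divr_gt0.
have [k1 k2 k3] : [/\ k < d1, k < d2 & k < d3].
  have : k < Num.min d1 (Num.min d2 d3) by rewrite ltr_pdivrMr// mulr_natr mulr2n ltrDl.
  by rewrite !lt_min => /andP[-> /andP[-> ->]].
set a := p.1; set b := p.2.
have nk (c x : R) : Num.min c (c + k) <= x <= Num.max c (c + k) -> `|c - x| <= k.
  by rewrite min_l ?max_r ?lerDl ?(ltW k0)// => ?; rewrite ler_norml; lra.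
have n0 (c : R) : `|c - c| = 0 by rewrite subrr normr0.
have nkk (c : R) : `|c - (c + k)| = k by rewrite opprD addNKr normrN gtr0_norm.
have nk3 (c : R) : `|c - (c + k)| < d3 by rewrite nkk.
have n03 (c : R) : `|c - c| < d3 by rewrite n0.
have kk : `|b + k - b| = k by rewrite addrC addKr gtr0_norm.
have kka : `|a + k - a| = k by rewrite addrC addKr gtr0_norm.
pose D := u (a + k, b + k) - u (a + k, b) - (u (a, b + k) - u (a, b)).
have I1 : `|D - pd ey (pd ex u) p * k * k| <= e / 2 * k * k.
  have := @mvt_slope (fun x => u (x, b + k) - u (x, b))
    (fun x => pd ex u (x, b + k) - pd ex u (x, b)) a (a + k)
    (pd ey (pd ex u) p * k) (e / 2 * k).
  rewrite kka (addrC a k) addrK (addrC k a); apply => x hx; have hxk := nk _ _ hx.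
  split.
    have x3 := le_lt_trans hxk k3.
    apply: has_der_subf.
    - by have [d _ _ _] := H3 (x, b + k) (conj x3 (nk3 b)); exact: (derivable_ex d).
    - by have [d _ _ _] := H3 (x, b) (conj x3 (n03 b)); exact: (derivable_ex d).
  have := H1 b (b + k) x; rewrite n0 nkk kk (addrC b k) addrK (addrC k b).
  by apply => //; exact: le_lt_trans k1.
have I2 : `|D - pd ex (pd ey u) p * k * k| <= e / 2 * k * k.
  have -> : D = u (a + k, b + k) - u (a, b + k) - (u (a + k, b) - u (a, b)).
    by rewrite /D; ring.
  have := @mvt_slope (fun y => u (a + k, y) - u (a, y))
    (fun y => pd ey u (a + k, y) - pd ey u (a, y)) b (b + k)
    (pd ex (pd ey u) p * k) (e / 2 * k).
  rewrite kk (addrC b k) addrK (addrC k b); apply => y hy; have hyk := nk _ _ hy.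
  split.
    have y3 := le_lt_trans hyk k3.
    apply: has_der_subf.
    - by have [_ d _ _] := H3 (a + k, y) (conj (nk3 a) y3); exact: (derivable_ey d).
    - by have [_ d _ _] := H3 (a, y) (conj (n03 a) y3); exact: (derivable_ey d).
  have := H2 a (a + k) y; rewrite n0 nkk kka (addrC a k) addrK (addrC k a).
  by apply => //; exact: le_lt_trans k2.
exact: (second_difference_close k0 I1 I2).
Qed.

(* [f = h_x - i h_y] is holomorphic and [dh = Re (f dz)]. *)
Lemma harmonic_holo (M : set C) (h : C -> R) (z0 : C) (rho : R) :
  harmonic_on M h -> Qdisc z0 rho `<=` M ->
  let f q := (pd ex h (z0 + q), - pd ey h (z0 + q)) in
  (exists g, holo (Qdisc 0 rho) f g) /\
  (forall p, Qdisc 0 rho p -> forall (c1 c2 : R -> R) (t x y : R),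
     (c1 t, c2 t) = p -> has_der t c1 x -> has_der t c2 y ->
     has_der t (fun s => h (z0 + (c1 s, c2 s))) (cmul (f p) (x, y)).1).
Proof.
move=> hh DM f.
have Dz p : Qdisc 0 rho p -> Qdisc z0 rho (z0 + p).
  by rewrite /Qdisc/= cdist0 cdistE (addrC z0 p) addrK.
have nD p : Qdisc 0 rho p -> \forall q \near z0 + p, M q.
  move=> /Dz H; apply: filterS DM _.
  by apply: open_nbhs_nbhs; split => //; exact: open_Qdisc.
have ct p : {for p, continuous (fun q => z0 + q)}.
  by apply: continuousD; [exact: cst_continuous|exact: cvg_id].
have exx : ex = ex :> C \/ ex = ey :> C by left.
have eyy : ey = ex :> C \/ ey = ey :> C by right.
have n1 p : Qdisc 0 rho p ->
    \forall q \near z0 + p, derivable h q ex /\ derivable h q ey.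
  move=> /nD; apply: filterS => q /hh[d _ _].
  by split; apply: d.
have n2 (u : C) p : u = ex \/ u = ey -> Qdisc 0 rho p ->
    \forall q \near z0 + p, derivable (pd u h) q ex /\ derivable (pd u h) q ey.
  move=> uE /nD; apply: filterS => q /hh[_ d _].
  by split; [have [] := d u ex uE exx|have [] := d u ey uE eyy].
have c2 (u v : C) p : u = ex \/ u = ey -> v = ex \/ v = ey -> Qdisc 0 rho p ->
    {for z0 + p, continuous (pd v (pd u h))}.
  by move=> uE vE /Dz/DM/hh[_ d _]; have [] := d u v uE vE.
have tr p (c1' c2' : R -> R) (t x y : R) : (c1' t, c2' t) = p ->
    has_der t c1' x -> has_der t c2' y ->
    [/\ (z0.1 + c1' t, z0.2 + c2' t) = z0 + p,
     has_der t (fun s => z0.1 + c1' s) x & has_der t (fun s => z0.2 + c2' s) y].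
  move=> <- d1 d2; split => //.
    by rewrite -[x]add0r; apply: has_der_addf => //; exact: has_der_cstf.
  by rewrite -[y]add0r; apply: has_der_addf => //; exact: has_der_cstf.
have ch (u : C) p : u = ex \/ u = ey -> Qdisc 0 rho p ->
  forall (c1 c2 : R -> R) (t x y : R),
  (c1 t, c2 t) = p -> has_der t c1 x -> has_der t c2 y ->
  has_der t (fun s => pd u h (z0 + (c1 s, c2 s)))
    (pd ex (pd u h) (z0 + p) * x + pd ey (pd u h) (z0 + p) * y).
  move=> uE Dp c1' c2' t x y cp d1 d2.
  have [e1 e2 e3] := tr _ _ _ _ _ _ cp d1 d2.
  exact: (chain_rule2 (c1 := fun s => z0.1 + c1' s) (c2 := fun s => z0.2 + c2' s)
    (n2 u p uE Dp) (c2 u ex p uE exx Dp) (c2 u ey p uE eyy Dp) e1 e2 e3).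
have cu (u : C) p : u = ex \/ u = ey -> Qdisc 0 rho p -> {for z0 + p, continuous (pd u h)}.
  by move=> uE Dp; apply: C1_continuous; [exact: n2|exact: c2|exact: c2].
(* [ring] would compare the partial derivatives up to unfolding. *)
have cr (a b b' x y : R) : a + b' = 0 -> - (b * x + b' * y) = a * y + - b * x.
  by move=> /eqP; rewrite addrC addr_eq0 => /eqP ->; ring.
(* The Cauchy-Riemann equations of [f] are this symmetry and the vanishing Laplacian [lap]. *)
have sym p : Qdisc 0 rho p -> pd ey (pd ex h) (z0 + p) = pd ex (pd ey h) (z0 + p).
  move=> Dp; apply: mixed_partials.
  - apply: filterS3 (n1 p Dp) (n2 ex p exx Dp) (n2 ey p eyy Dp).
    by move=> q [? ?] [? ?] [? ?]; split.
  - exact: c2.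
  - exact: c2.
split.
  exists (fun q => (pd ex (pd ex h) (z0 + q), - pd ex (pd ey h) (z0 + q))).
  move=> p Dp.
  have lap : pd ex (pd ex h) (z0 + p) + pd ey (pd ey h) (z0 + p) = 0.
    by have [_ _] := hh _ (DM _ (Dz _ Dp)).
  split.
  - apply: continuous_pair_at.
      by apply: (@continuous_comp _ _ _ (fun q => z0 + q) (pd ex h)); [exact: ct|exact: cu].
    apply: continuousN.
    by apply: (@continuous_comp _ _ _ (fun q => z0 + q) (pd ey h)); [exact: ct|exact: cu].
  - apply: continuous_pair_at.
      by apply: (@continuous_comp _ _ _ (fun q => z0 + q) (pd ex (pd ex h)));
        [exact: ct|exact: c2].
    apply: continuousN.
    by apply: (@continuous_comp _ _ _ (fun q => z0 + q) (pd ex (pd ey h)));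
      [exact: ct|exact: c2].
  - move=> c1' c2' t x y cp d1 d2; split => /=.
      apply: has_der_val_eq; first exact: (ch ex p exx Dp _ _ _ _ _ cp d1 d2).
      by rewrite sym// mulNr opprK.
    apply: has_der_val_eq.
      by apply: has_der_oppf; exact: (ch ey p eyy Dp _ _ _ _ _ cp d1 d2).
    exact: cr lap.
move=> p Dp c1' c2' t x y cp d1 d2.
have [e1 e2 e3] := tr _ _ _ _ _ _ cp d1 d2.
apply: has_der_val_eq.
  exact: (chain_rule2 (c1 := fun s => z0.1 + c1' s) (c2 := fun s => z0.2 + c2' s)
    (n1 p Dp) (cu ex p exx Dp) (cu ey p eyy Dp) e1 e2 e3).
by rewrite /cmul/= mulNr opprK.
Qed.

(** The case [x = 0] relies on [ln 0 = 0]. It lets [log_holo] rewrite the whole function of [s],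
    even where the path meets [w]. *)
Lemma ln_sqrt (x : R) : 0 <= x -> ln (Num.sqrt x) = 2^-1 * ln x.
Proof.
rewrite le_eqVlt => /predU1P[<-|x0]; first by rewrite sqrtr0 ln0// mulr0.
by rewrite -{2}(sqr_sqrtr (ltW x0)) lnXn ?sqrtr_gt0// mulr2n; field.
Qed.

(** For [u = ln |. - w|] one has explicitly [u_x - i u_y = 1 / (q - w)]; [rho <= cnorm w] keeps the
    pole out of the open disc. *)
Lemma log_holo (w : C) (rho : R) : rho <= cnorm w ->
  let f q := cinv (q - w) in
  (exists g, holo (Qdisc 0 rho) f g) /\
  (forall p, Qdisc 0 rho p -> forall (c1 c2 : R -> R) (t x y : R),
     (c1 t, c2 t) = p -> has_der t c1 x -> has_der t c2 y ->
     has_der t (fun s => ln (cdist (c1 s, c2 s) w)) (cmul (f p) (x, y)).1).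
Proof.
move=> rw f.
have nz p : Qdisc 0 rho p -> p - w != 0.
  rewrite /Qdisc/= cdist0 => pr; apply/eqP => /subr0_eq e.
  by move: (lt_le_trans pr rw); rewrite e ltxx.
split.
  eexists; apply: holo_inv => //.
  have := @holo_affine _ (Qdisc 0 rho) (1, 0) (- w).
  rewrite (_ : (fun p => _) = (fun p => p - w)); first exact.
  apply/funext => p; rewrite addrC; congr (_ - _).
  by rewrite /cmul/= !mul1r !mul0r subr0 addr0 -surjective_pairing.
move=> p Dp c1 c2 t x y cp d1 d2.
have n0 := normsq_gt0 (nz p Dp).
have a1 := has_der_subf d1 (has_der_cstf w.1 t).
have a2 := has_der_subf d2 (has_der_cstf w.2 t).
have dn := has_der_addf (has_der_mulf a1 a1) (has_der_mulf a2 a2).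
have n1 : 0 < (c1 t - w.1) * (c1 t - w.1) + (c2 t - w.2) * (c2 t - w.2).
  by move: n0; rewrite -cp /= !expr2.
have dl : has_der t (fun s => ln ((c1 s - w.1) * (c1 s - w.1) +
    (c2 s - w.2) * (c2 s - w.2))) _ :=
  @is_derive1_comp _ (@ln R) _ t _ _ (is_derive1_ln n1) dn.
have -> : (fun s => ln (cdist (c1 s, c2 s) w)) = (fun s => 2^-1 *
    ln ((c1 s - w.1) * (c1 s - w.1) + (c2 s - w.2) * (c2 s - w.2))).
  by apply/funext => s; rewrite -ln_sqrt// addr_ge0// -expr2 sqr_ge0.
apply: has_der_val_eq; first exact: (has_der_mulf (has_der_cstf 2^-1 t) dl).
rewrite /f -cp /cmul /cinv/=; move: n1.
move: (c1 t - w.1) (c2 t - w.2) (ln _) => A B l n1.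
by field; rewrite !expr2 gt_eqF.
Qed.

End two_variables.

(** * Weighted pushforward of a measure *)

(** The image under [phi] of the measure of density [g]. The hypotheses are arguments so that
    unification can find the measure structure attached to the term. *)
Definition wpush d1 d2 (X : measurableType d1) (Y : measurableType d2)
    (R : realType) (mu : {measure set X -> \bar R}) (phi : X -> Y) (g : X -> R)
    of measurable_fun setT phi & (forall x, 0 <= g x) &
       mu.-integrable setT (EFin \o g) :=
  fun A : set Y => (\int[mu]_(x in phi @^-1` A) (g x)%:E)%E.

Section weighted_pushforward.
Context d1 d2 (X : measurableType d1) (Y : measurableType d2) (R : realType).
Variables (mu : {measure set X -> \bar R}) (phi : X -> Y) (g : X -> R).
Hypotheses (mphi : measurable_fun setT phi) (g0 : forall x, 0 <= g x).
Hypothesis intg : mu.-integrable setT (EFin \o g).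
Local Open Scope ereal_scope.

Local Notation sig := (wpush mphi g0 intg).

Let mpre A : measurable A -> measurable (phi @^-1` A).
Proof. by move=> mA; rewrite -[X in measurable X]setTI; exact: mphi. Qed.

Let mg : measurable_fun setT (fun x => (g x)%:E).
Proof. exact: measurable_int intg. Qed.

Let sig0 : sig set0 = 0.
Proof. by rewrite /wpush preimage_set0 integral_set0. Qed.

Let sig_ge0 A : 0 <= sig A.
Proof. by apply: integral_ge0 => x _; rewrite lee_fin. Qed.

Let sig_sigma_additive : semi_sigma_additive sig.
Proof.
move=> F mF tF mUF; rewrite /wpush preimage_bigcup.
apply: (@semi_sigma_additive_nng_induced _ _ _ mu (EFin \o g)) => //.
- by move=> n; exact: mpre.
- apply/trivIsetP => /= i j _ _ ij; rewrite -preimage_setI.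
  by move/trivIsetP : tF => /(_ _ _ _ _ ij) ->//; rewrite preimage_set0.
- by rewrite -preimage_bigcup; exact: mpre.
Qed.

HB.instance Definition _ := isMeasure.Build _ _ _ sig
  sig0 sig_ge0 sig_sigma_additive.

Let sig_fin : fin_num_fun sig.
Proof.
move=> A mA; apply: integrable_fin_num; first exact: mpre.
by apply: integrableS intg => //; exact: mpre.
Qed.

HB.instance Definition _ := Measure_isFinite.Build _ _ _ sig sig_fin.

Import HBNNSimple.

Let integral_wpush_nnsfun (D : set Y) (h : {nnsfun Y >-> R}) : measurable D ->
  \int[sig]_(y in D) (h y)%:E =
  \int[mu]_(x in phi @^-1` D) ((h (phi x))%:E * (g x)%:E).
Proof.
move=> mD; have mE := mpre mD.
transitivity (\int[sig]_(y in D)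
    (\sum_(r \in range h) (r * \1_(h @^-1` [set r]) y)%:E)).
  by apply: eq_integral => y _; rewrite fimfunE -fsumEFin.
rewrite ge0_integral_fsum//; last 2 first.
- move=> r; apply/measurable_EFinP/measurable_funTS.
  by apply: measurable_funM => //; exact: measurable_indic.
- by move=> r y _; exact: nnfun_muleindic_ge0.
transitivity (\int[mu]_(x in phi @^-1` D) (\sum_(r \in range h)
    ((r * \1_(h @^-1` [set r]) (phi x))%:E * (g x)%:E))); last first.
  apply: eq_integral => x _.
  rewrite -ge0_mule_fsuml; last by move=> r; exact: nnfun_muleindic_ge0.
  by rewrite fsumEFin// -fimfunE.
have mi r : measurable_fun (phi @^-1` D)
    (fun x => (\1_(h @^-1` [set r]) (phi x))%:E : \bar R).
  apply: measurable_funTS; apply/measurable_EFinP.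
  by apply: measurableT_comp => //; exact: measurable_indic.
have mgD : measurable_fun (phi @^-1` D) (fun x => (g x)%:E) by exact: measurable_funTS.
rewrite ge0_integral_fsum//; last 2 first.
- move=> r; apply: emeasurable_funM => //.
  by under eq_fun do rewrite EFinM; apply: emeasurable_funM.
- by move=> r x _; rewrite mule_ge0 ?lee_fin//; exact: nnfun_muleindic_ge0.
apply: eq_fsbigr => r /set_mem[y _ hr].
have r0 : (0 <= r)%R by rewrite -hr.
under eq_integral do rewrite EFinM.
under [RHS]eq_integral do rewrite EFinM -muleA.
rewrite !ge0_integralZl//.
- congr (_ * _); rewrite integral_indic//.
  rewrite -[LHS]/(wpush mphi g0 intg _) /wpush preimage_setI setIC integral_mkcondr.
  apply: eq_integral => x _; rewrite patchE indicE.
  have -> : (x \in phi @^-1` (h @^-1` [set r])) = (phi x \in h @^-1` [set r]).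
    by apply/idP/idP; rewrite !inE.
  by case: ifPn; rewrite ?mul1e ?mul0e.
- by apply: emeasurable_funM.
- by move=> x _; rewrite mule_ge0// lee_fin.
- apply/measurable_EFinP/measurable_funTS; exact: measurable_indic.
Qed.

Lemma ge0_integral_wpush (D : set Y) (f : Y -> \bar R) : measurable D ->
  measurable_fun D f -> (forall y, D y -> 0 <= f y) ->
  \int[sig]_(y in D) f y = \int[mu]_(x in phi @^-1` D) (f (phi x) * (g x)%:E).
Proof.
move=> mD mf f0; have mE := mpre mD.
pose h := nnsfun_approx mD mf.
have hf y : D y -> (h n y)%:E @[n --> \oo] --> f y.
  by move=> Dy; exact: cvg_nnsfun_approx.
transitivity (\int[sig]_(y in D) limn (fun n => (h n y)%:E)).
  by apply: eq_integral => y /set_mem Dy; apply/esym/cvg_lim => //; exact: hf.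
have mh n : measurable_fun D (fun y => (h n y)%:E).
  exact/measurable_EFinP/measurable_funTS.
have ndh y : nondecreasing_seq (fun n => (h n y)%:E).
  by move=> a b ab; rewrite lee_fin; exact/lefP/nd_nnsfun_approx.
rewrite monotone_convergence//; last by move=> n y _; rewrite lee_fin.
transitivity (\int[mu]_(x in phi @^-1` D)
    limn (fun n => (h n (phi x))%:E * (g x)%:E)); last first.
  apply: eq_integral => x /set_mem Dx; apply/cvg_lim => //.
  by apply: cvgeZr => //; exact: hf.
rewrite monotone_convergence//.
- by congr (lim (_ @ \oo)); apply/funext => n; rewrite integral_wpush_nnsfun.
- move=> n; apply: emeasurable_funM; last exact: measurable_funTS.
  by apply: measurable_funTS; apply/measurable_EFinP; exact: measurableT_comp.
- by move=> n x _; rewrite mule_ge0// lee_fin.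
- move=> x _ a b ab; rewrite lee_wpmul2r ?lee_fin//.
  by have := ndh (phi x) a b ab; rewrite lee_fin.
Qed.

(** Adding the bound [K] makes the integrand nonnegative; since the measures involved are finite,
    the integral of [K] can be cancelled afterwards. *)
Lemma Rintegral_wpush (D : set Y) (f : Y -> R) (K : R) : measurable D ->
  measurable_fun D f -> (forall y, D y -> `|f y| <= K)%R ->
  (\int[sig]_(y in D) f y = \int[mu]_(x in phi @^-1` D) (f (phi x) * g x))%R.
Proof.
move=> mD mf fK; have mE := mpre mD.
have mfK : measurable_fun D (fun y => (f y + K)%:E).
  by apply/measurable_EFinP; exact: measurable_funD.
have iK : sig.-integrable D (EFin \o cst K).
  apply: measurable_bounded_integrable => //; last exact: bounded_cst.
  by rewrite -ge0_fin_numE//; exact: sig_fin.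
have if_ : sig.-integrable D (EFin \o f).
  apply: measurable_bounded_integrable => //.
    by rewrite -ge0_fin_numE//; exact: sig_fin.
  exists K; split; first exact: num_real.
  by move=> M KM y Dy; apply: (le_trans (fK _ Dy)); exact: ltW.
have igE : mu.-integrable (phi @^-1` D) (EFin \o g) by exact: integrableS intg.
have ifg : mu.-integrable (phi @^-1` D) (EFin \o (fun x => f (phi x) * g x)%R).
  apply: (le_integrable mE _ _ (integrableZl mE K igE)).
    apply/measurable_EFinP; apply: measurable_funM.
      apply: (measurable_comp mD _ mf); first by move=> _ [x Dx <-].
      exact: measurable_funTS.
    exact/measurable_EFinP/measurable_funTS.
  move=> x Dx /=; rewrite lee_fin !normrM ler_wpM2r//.
  by apply: le_trans (fK _ Dx) _; exact: ler_norm.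
have Kg : (\int[mu]_(x in phi @^-1` D) (K * g x) =
   \int[sig]_(y in D) K)%R.
  rewrite RintegralZl// Rintegral_cst//.
have H : (\int[sig]_(y in D) (f y + K) =
   \int[mu]_(x in phi @^-1` D) (f (phi x) * g x + K * g x))%R.
  rewrite /Rintegral ge0_integral_wpush//.
    by congr fine; apply: eq_integral => x _; rewrite -EFinM mulrDl.
  by move=> y /fK; rewrite lee_fin ler_norml => /andP[? _]; lra.
have iKg : mu.-integrable (phi @^-1` D) (EFin \o (fun x => K * g x)%R).
  exact: (integrableZl mE K igE).
by move: H; rewrite (RintegralD mD if_ iK) (RintegralD mE ifg iKg) Kg => /addIr.
Qed.

End weighted_pushforward.

(** * Jordan decomposition *)

Section jordan.
Context {R : realType} d (T : measurableType d).
Implicit Types nu : {charge set T -> \bar R}.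
Local Open Scope ereal_scope.

Lemma hahn_PNP nu : hahn_decomposition nu (sval (hahn_PN nu)).1 (sval (hahn_PN nu)).2.
Proof. exact: (svalP (hahn_PN nu)). Qed.

Lemma jposE nu A : measurable A -> jpos nu A = nu (A `&` (sval (hahn_PN nu)).1).
Proof.
by move=> mA; rewrite /jpos jordan_posE cjordan_posE /crestr0 mem_set.
Qed.

Lemma jnegE nu A : measurable A -> jneg nu A = - nu (A `&` (sval (hahn_PN nu)).2).
Proof.
by move=> mA; rewrite /jneg jordan_negE cjordan_negE /crestr0 mem_set.
Qed.

Lemma jpos_fin nu A : measurable A -> jpos nu A \is a fin_num.
Proof.
move=> mA; rewrite jposE// fin_num_measure//.
by have [[? _] _ _ _] := hahn_PNP nu; exact: measurableI.
Qed.

Lemma jneg_fin nu A : measurable A -> jneg nu A \is a fin_num.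
Proof.
move=> mA; rewrite jnegE// fin_numN fin_num_measure//.
by have [_ [? _] _ _] := hahn_PNP nu; exact: measurableI.
Qed.

Lemma chargeE nu A : measurable A -> nu A = jpos nu A - jneg nu A.
Proof.
move=> mA; rewrite jposE// jnegE// oppeK.
by have [[mP _] [mN _] PN PN0] := hahn_PNP nu; exact: charge_partition.
Qed.

Lemma charge_le_jpos nu A : measurable A -> nu A <= jpos nu A.
Proof.
by move=> mA; rewrite chargeE// leeBlDr ?jneg_fin// leeDl.
Qed.

Lemma chargeN_le_jneg nu A : measurable A -> - nu A <= jneg nu A.
Proof.
move=> mA; rewrite chargeE// fin_num_oppeB ?jneg_fin//.
by rewrite addeC leeBlDr ?jpos_fin// leeDl.
Qed.

(** On the part of [A] lying in [P] and in [N'], [nu] is nonnegative by the first Hahn decomposition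
    and nonpositive, being equal to [nu'], by the second. So the two Hahn decompositions disagree
    only on null parts. *)
Lemma jordan_local nu nu' D : measurable D ->
  (forall A, measurable A -> A `<=` D -> nu A = nu' A) ->
  forall A, measurable A -> A `<=` D ->
    jpos nu A = jpos nu' A /\ jneg nu A = jneg nu' A.
Proof.
move=> mD E A mA AD.
have [[mP pP] [mN nN] PN PN0] := hahn_PNP nu.
have [[mP' pP'] [mN' nN'] PN' PN0'] := hahn_PNP nu'.
set P := (sval _).1 in mP pP PN PN0 *; set N := (sval _).2 in mN nN PN PN0 *.
set P' := (sval _).1 in mP' pP' PN' PN0' *; set N' := (sval _).2 in mN' nN' PN' PN0' *.
have m1 : measurable (A `&` P `&` N') by apply: measurableI => //; exact: measurableI.
have m2 : measurable (A `&` N `&` P') by apply: measurableI => //; exact: measurableI.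
have z1 : nu (A `&` P `&` N') = 0.
  apply/eqP; rewrite eq_le; apply/andP; split.
    rewrite E; [|by []|by move=> x [[/AD]]].
    by apply: nN'; [by []|move=> x []].
  by apply: pP; [by []|move=> x [[]]].
have z2 : nu (A `&` N `&` P') = 0.
  apply/eqP; rewrite eq_le; apply/andP; split.
    by apply: nN; [by []|move=> x [[]]].
  rewrite E; [|by []|by move=> x [[/AD]]].
  by apply: pP'; [by []|move=> x []].
have e1 : jpos nu A = jpos nu' A.
  rewrite !jposE// -/P -/P'.
  rewrite (charge_partition nu (measurableI _ _ mA mP) mP' mN' PN' PN0').
  rewrite z1 adde0 -E; [|exact: measurableI|by move=> x [/AD]].
  rewrite (charge_partition nu (measurableI _ _ mA mP') mP mN PN PN0).
  by rewrite (setIAC A P' N) z2 adde0 setIAC.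
split => //.
have := E A mA AD; rewrite !chargeE// e1 => /(congr1 (fun x => jpos nu' A - x)).
by rewrite !fin_num_oppeB ?jneg_fin// !addeA !subee ?jpos_fin// !add0e.
Qed.

(** Any decomposition [nu = m1 - m2] may replace the Jordan one, because [jpos nu + m2] and
    [jneg nu + m1] are the same measure on [D]. The Jordan parts of the swept charge are not
    explicit near the circle. *)
Lemma Rintegral_jordan nu (m1 m2 : {measure set T -> \bar R}) (D : set T)
    (f : T -> R) (K : R) : measurable D -> m1 D < +oo -> m2 D < +oo ->
  (forall A, measurable A -> A `<=` D -> nu A + m2 A = m1 A) ->
  measurable_fun D f -> (forall x, D x -> `|f x| <= K)%R ->
  (\int[jpos nu]_(x in D) f x - \int[jneg nu]_(x in D) f x =
   \int[m1]_(x in D) f x - \int[m2]_(x in D) f x)%R.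
Proof.
move=> mD f1 f2 E mf fK.
have bi (m : {measure set T -> \bar R}) : m D < +oo -> m.-integrable D (EFin \o f).
  move=> mfin; apply: measurable_bounded_integrable => //.
  exists K; split; first exact: num_real.
  by move=> M KM y Dy; apply: (le_trans (fK _ Dy)); exact: ltW.
have ip : (jpos nu).-integrable D (EFin \o f).
  by apply: bi; rewrite ltey_eq jpos_fin.
have in_ : (jneg nu).-integrable D (EFin \o f).
  by apply: bi; rewrite ltey_eq jneg_fin.
have i1 := bi m1 f1; have i2 := bi m2 f2.
have H : \int[measure_add (jpos nu) m2]_(x in D) (f x)%:E =
         \int[measure_add (jneg nu) m1]_(x in D) (f x)%:E.
  apply: eq_measure_integral => A mA AD.
  transitivity (jpos nu A + m2 A); first exact: measure_addE.
  transitivity (jneg nu A + m1 A); last exact/esym/measure_addE.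
  rewrite -E// (chargeE nu mA) addeA; congr (_ + _).
  by rewrite addeCA subee ?jneg_fin// adde0.
have {}H : (\int[jpos nu]_(x in D) f x + \int[m2]_(x in D) f x =
    \int[jneg nu]_(x in D) f x + \int[m1]_(x in D) f x)%R.
  have := congr1 fine H.
  rewrite (integral_measure_add mD ip i2) (integral_measure_add mD in_ i1).
  by rewrite (fineD (integrable_fin_num mD ip) (integrable_fin_num mD i2))
    (fineD (integrable_fin_num mD in_) (integrable_fin_num mD i1)).
by apply/eqP; rewrite subr_eq addrAC eq_sym subr_eq eq_sym H addrC.
Qed.

(** The two parts are values of [nu] and of [- nu] on subsets of [A], so one-sided bounds on all
    subsets suffice and the Hahn sets need not be known. *)
Lemma tvar_le nu (mp mn : \bar R) A : measurable A ->
  (forall B, measurable B -> B `<=` A -> nu B <= mp) ->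
  (forall B, measurable B -> B `<=` A -> - nu B <= mn) ->
  tvar nu A <= mp + mn.
Proof.
move=> mA hp hn; have [[mP _] [mN _] _ _] := hahn_PNP nu.
rewrite /tvar jposE// jnegE//.
by apply: leeD; [apply: hp|apply: hn] => //; try exact: measurableI; move=> x [].
Qed.

(* [f] may be non-integrable (with integral [-oo]) on [D]. *)
Lemma integral_split (mu : {measure set T -> \bar R}) (D E : set T)
    (f : T -> \bar R) : measurable D -> measurable E -> D `&` E = set0 ->
  mu (~` (D `|` E)) = 0 -> measurable_fun setT f ->
  \int[mu]_(x in D) f^\+ x < +oo -> mu.-integrable E f ->
  \int[mu]_x f x = \int[mu]_(x in D) f x + \int[mu]_(x in E) f x /\
  \int[mu]_(x in D) f x < +oo.
Proof.
move=> mD mE DE0 N0 mf Dfin iE.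
have mN : measurable (~` (D `|` E)) by apply: measurableC; exact: measurableU.
have S g : measurable_fun setT g -> (forall x, 0 <= g x) ->
    \int[mu]_x g x = \int[mu]_(x in D) g x + \int[mu]_(x in E) g x.
  move=> mg g0; rewrite -(setUv (D `|` E)) ge0_integral_setU//; last 3 first.
  - exact: measurableU.
  - exact: measurable_funTS.
  - by apply/disj_setPS; rewrite setICr.
  rewrite [X in _ + X](null_set_integral mN)//; last exact: measurable_funTS.
  rewrite adde0 ge0_integral_setU//; first exact: measurable_funTS.
  by apply/disj_setPS; rewrite DE0.
rewrite integralE (S f^\+) ?(S f^\-)//; [|exact: measurable_funeneg|exact: measurable_funepos].
rewrite [X in _ = X + _]integralE [X in _ = _ + X]integralE [X in _ /\ X < _]integralE.
have b1 := integrable_pos_fin_num mE iE.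
have b2 := integrable_neg_fin_num mE iE.
have a1 : \int[mu]_(x in D) f^\+ x \is a fin_num.
  by rewrite ge0_fin_numE// integral_ge0.
have a2 : 0 <= \int[mu]_(x in D) f^\- x by exact: integral_ge0.
move: a1 a2 b1 b2; move: (\int[mu]_(x in D) f^\+ x) (\int[mu]_(x in D) f^\- x)
  (\int[mu]_(x in E) f^\+ x) (\int[mu]_(x in E) f^\- x).
move=> [a| |] [b| |] [c| |] [e| |]//= _ _ _ _; split => //.
- by rewrite -!EFinD; congr EFin; ring.
- by rewrite -EFinD ltry.
Qed.

End jordan.

(** * Sweeping the logarithmic potential *)

Section bounded_integrals.
Context {R : realType}.

Lemma bounded_integrable d (T : measurableType d) (mu : {measure set T -> \bar R})
    (D : set T) (f : T -> R) (K : R) : measurable D -> (mu D < +oo)%E ->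
  measurable_fun D f -> (forall x, D x -> `|f x| <= K) ->
  mu.-integrable D (EFin \o f).
Proof.
move=> mD fD mf fK; apply: measurable_bounded_integrable => //.
exists K; split; first exact: num_real.
by move=> M KM y Dy; apply: (le_trans (fK _ Dy)); exact: ltW.
Qed.

Context d1 d2 (T1 : measurableType d1) (T2 : measurableType d2).
Variables (m1 : {sigma_finite_measure set T1 -> \bar R})
          (m2 : {sigma_finite_measure set T2 -> \bar R}).
Variables (A : set T1) (B : set T2) (f : T1 * T2 -> R) (K : R).
Hypotheses (mA : measurable A) (mB : measurable B).
Hypotheses (fA : (m1 A < +oo)%E) (fB : (m2 B < +oo)%E).
Hypothesis mf : measurable_fun setT f.
Hypothesis fK : forall x y, A x -> B y -> `|f (x, y)| <= K.

(** Fubini is applied on the whole product, to [f] extended by zero. *)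
Let g : T1 * T2 -> \bar R := (EFin \o f) \_ (A `*` B).

Let ig : (m1 \x m2)%E.-integrable setT g.
Proof.
have mAB : measurable (A `*` B) by exact: measurableX.
apply/(integrable_mkcond _ mAB).
apply: (@bounded_integrable _ _ _ _ _ K) => //.
- have e : (m1 \x m2)%E (A `*` B) = (m1 A * m2 B)%E by exact: product_measure1E.
  by apply: (eq_ind_r (fun x => x < +oo)%E _ e); rewrite lte_mul_pinfty// ge0_fin_numE.
- exact: measurable_funTS.
- by move=> [x y] [/= Ax By]; exact: fK.
Qed.

Let gE1 x : (\int[m2]_y g (x, y) =
  ((fun x => \int[m2]_(y in B) (f (x, y))%:E) \_ A) x)%E.
Proof.
rewrite patchE; case: ifPn => [/set_mem Ax|/negP nAx].
  rewrite [RHS]integral_mkcond; apply: eq_integral => y _.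
  rewrite /g !patchE; congr (if _ then _ else _).
  by apply/idP/idP; rewrite !inE/=; [move=> []|split].
rewrite integral0_eq// => y _; rewrite /g patchE ifF//.
by apply/negP; rewrite inE/= => -[Ax _]; apply: nAx; rewrite inE.
Qed.

Let gE2 y : (\int[m1]_x g (x, y) =
  ((fun y => \int[m1]_(x in A) (f (x, y))%:E) \_ B) y)%E.
Proof.
rewrite patchE; case: ifPn => [/set_mem By|/negP nBy].
  rewrite [RHS]integral_mkcond; apply: eq_integral => x _.
  rewrite /g !patchE; congr (if _ then _ else _).
  by apply/idP/idP; rewrite !inE/=; [move=> []|split].
rewrite integral0_eq// => x _; rewrite /g patchE ifF//.
by apply/negP; rewrite inE/= => -[_ By]; apply: nBy; rewrite inE.
Qed.

Let i1 x : A x -> m2.-integrable B (EFin \o (fun y => f (x, y))).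
Proof.
move=> Ax; apply: (@bounded_integrable _ _ _ _ _ K) => //.
  by apply: measurable_funTS; exact: measurableT_comp.
by move=> y By; exact: fK.
Qed.

Let i2 y : B y -> m1.-integrable A (EFin \o (fun x => f (x, y))).
Proof.
move=> By; apply: (@bounded_integrable _ _ _ _ _ K) => //.
  by apply: measurable_funTS; exact: measurableT_comp.
by move=> x Ax; exact: fK.
Qed.

Lemma measurable_Rintegral :
  measurable_fun A (fun x => \int[m2]_(y in B) f (x, y)).
Proof.
have H : measurable_fun A (fun x => \int[m2]_(y in B) (f (x, y))%:E)%E.
  apply/(measurable_restrictT _ mA).
  have := measurable_fubini_F ig; congr (measurable_fun _ _).
  by apply/funext => x; rewrite /fubini_F gE1.
exact: (measurable_comp measurableT _ _ H).
Qed.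

Lemma Rintegral_exchange :
  \int[m1]_(x in A) (\int[m2]_(y in B) f (x, y)) =
  \int[m2]_(y in B) (\int[m1]_(x in A) f (x, y)).
Proof.
have := Fubini ig.
under eq_integral do rewrite gE1.
under [X in _ = X -> _]eq_integral do rewrite gE2.
rewrite -!integral_mkcond => H.
transitivity (fine (\int[m1]_(x in A) \int[m2]_(y in B) (f (x, y))%:E)%E).
  congr fine; apply: eq_integral => x /set_mem Ax.
  by rewrite fineK//; exact: integrable_fin_num (i1 Ax).
rewrite H; congr fine; apply: eq_integral => y /set_mem By.
by rewrite fineK//; exact: integrable_fin_num (i2 By).
Qed.

End bounded_integrals.

(** * The logarithmic kernel and the sweeping of outer mass onto a circle *)

Section log_potential.
Context {R : realType}.
Local Notation C := (R * R)%type.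
Implicit Types z w : C.

Lemma ln_bound (a b x : R) : 0 < a -> a <= x -> x <= b ->
  `|ln x| <= `|ln a| + `|ln b|.
Proof.
move=> a0 ax xb; have x0 : 0 < x by exact: lt_le_trans ax.
have b0 : 0 < b by exact: lt_le_trans xb.
have h1 : ln a <= ln x by rewrite ler_ln.
have h2 : ln x <= ln b by rewrite ler_ln.
have h3 := ler_norm (ln b); have h4 := ler_norm (- ln a); rewrite normrN in h4.
have h5 := normr_ge0 (ln a); have h6 := normr_ge0 (ln b).
by rewrite ler_norml; lra.
Qed.

Lemma measurable_cdist2 d (T : measurableType d) (f g : T -> C) :
  measurable_fun setT f -> measurable_fun setT g ->
  measurable_fun setT (fun x => cdist (f x) (g x)).
Proof.
move=> mf mg.
have f1 := measurableT_comp (@measurable_fst _ _ R R) mf.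
have f2 := measurableT_comp (@measurable_snd _ _ R R) mf.
have g1 := measurableT_comp (@measurable_fst _ _ R R) mg.
have g2 := measurableT_comp (@measurable_snd _ _ R R) mg.
apply: (measurableT_comp (f := @Num.sqrt R)).
  by apply: continuous_measurable_fun; exact: sqrt_continuous.
by apply: measurable_funD; apply: measurable_funX; exact: measurable_funB.
Qed.

Lemma measurable_cdist z : measurable_fun setT (cdist z).
Proof. by apply: measurable_cdist2; [exact: measurable_cst|exact: measurable_id]. Qed.

Lemma measurable_ln_cdist z : measurable_fun setT (fun w => ln (cdist z w)).
Proof. by apply: measurableT_comp; [exact: measurable_ln|exact: measurable_cdist]. Qed.

Lemma measurable_Qdisc z r : measurable (Qdisc z r).
Proof.
have -> : Qdisc z r = setT `&` cdist z @^-1` `]-oo, r[.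
  by rewrite setTI; apply/seteqP; split => w; rewrite /Qdisc/= cdistC in_itv.
by apply: measurable_cdist.
Qed.

Lemma cdist_eq0 z w : (cdist z w == 0) = (z == w).
Proof. by rewrite cdistE cnorm_eq0 subr_eq0. Qed.

Lemma measurable_lnk z : measurable_fun setT (lnk z).
Proof.
rewrite /lnk; under eq_fun do rewrite -cdist_eq0.
apply: measurable_fun_if => //.
- by apply: measurable_fun_eqr; [exact: measurable_cdist|exact: measurable_cst].
- apply: measurable_funTS; apply/measurable_EFinP; exact: measurable_ln_cdist.
Qed.

Lemma measurable_point z : measurable [set z].
Proof.
have -> : [set z] = setT `&` cdist z @^-1` [set 0].
  rewrite setTI; apply/seteqP; split => w /=.
    by move=> ->; apply/eqP; rewrite cdist_eq0.
  by move/eqP; rewrite cdist_eq0 => /eqP.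
by apply: measurable_cdist.
Qed.

(** The layer density of [ln |. - w|], with [z0] moved to the origin. *)
Definition nker (r : R) z0 w (t : R) : R :=
  ndens r (fun q => cinv (q - (w - z0))) t.

(** With the inverse written as a real power, measurability in [(t, w)] jointly, as Fubini requires,
    follows from [measurable_powR]. *)
Lemma nkerE r z0 w t : let a := (circ r t).1 - (w.1 - z0.1) in
  let b := (circ r t).2 - (w.2 - z0.2) in
  nker r z0 w t = - pi^-1 * (((circ r t).1 * a + (circ r t).2 * b) *
     (a ^+ 2 + b ^+ 2) `^ (-1)).
Proof.
move=> a b; rewrite powR_inv1 ?addr_ge0 ?sqr_ge0//.
rewrite /nker /ndens /cmul /cinv -/a -/b /= -/a -/b; ring.
Qed.

Lemma measurable_circ r : measurable_fun setT (circ r : measurableTypeR R -> C).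
Proof.
apply/measurable_fun_pairP; split; apply: measurable_funM => //;
  apply: continuous_measurable_fun; [exact: continuous_cos|exact: continuous_sin].
Qed.

Lemma measurable_shift_circ r z0 :
  measurable_fun setT ((fun t => z0 + circ r t) : measurableTypeR R -> C).
Proof.
have mc := measurable_circ r.
have -> : (fun x : measurableTypeR R => z0 + circ r x) =
  (fun x => (z0.1 + (circ r x).1, z0.2 + (circ r x).2)) by [].
apply/measurable_fun_pairP; split; apply: measurable_funD => //.
  exact: (measurableT_comp (@measurable_fst _ _ R R) mc).
exact: (measurableT_comp (@measurable_snd _ _ R R) mc).
Qed.

Lemma measurable_nker r z0 :
  measurable_fun setT (fun p : (measurableTypeR R * C)%type => nker r z0 p.2 p.1).
Proof.
under eq_fun do rewrite nkerE.
have mt : measurable_fun setT (fun p : (measurableTypeR R * C)%type => circ r p.1).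
  by apply: measurableT_comp; [exact: measurable_circ|exact: measurable_fst].
have c1 := measurableT_comp (@measurable_fst _ _ R R) mt.
have c2 := measurableT_comp (@measurable_snd _ _ R R) mt.
have w1 := measurableT_comp (@measurable_fst _ _ R R)
  (@measurable_snd _ _ (measurableTypeR R) C).
have w2 := measurableT_comp (@measurable_snd _ _ R R)
  (@measurable_snd _ _ (measurableTypeR R) C).
have a1 : measurable_fun setT (fun p : (measurableTypeR R * C)%type =>
    (circ r p.1).1 - (p.2.1 - z0.1)).
  by apply: measurable_funB => //; exact: measurable_funB.
have a2 : measurable_fun setT (fun p : (measurableTypeR R * C)%type =>
    (circ r p.1).2 - (p.2.2 - z0.2)).
  by apply: measurable_funB => //; exact: measurable_funB.
apply: measurable_funM => //; apply: measurable_funM.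
  by apply: measurable_funD; exact: measurable_funM.
apply: (measurableT_comp (f := fun x : R => x `^ (-1))).
  exact: measurable_powR.
by apply: measurable_funD; exact: measurable_funX.
Qed.

Lemma measurable_nker1 r z0 t : measurable_fun setT (fun w => nker r z0 w t).
Proof.
exact: (measurableT_comp (measurable_nker r z0)
  (@pair1_measurable _ _ (measurableTypeR R) C t)).
Qed.

Lemma nker_bound r z0 w t : 0 < r -> r < cdist w z0 ->
  `|nker r z0 w t| <= pi^-1 * (r / (cdist w z0 - r)).
Proof.
move=> r0 rw; apply: ndens_bound => //.
have h : cdist w z0 - r <= cnorm (circ r t - (w - z0)).
  have := cdist_triangle (w - z0) (circ r t) 0.
  rewrite !cdist0 cdistC -cdistE cnorm_circ; last exact: ltW.
  by rewrite [cdist (circ r t) _]cdistE; lra.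
rewrite cnorm_inv; first by rewrite lef_pV2 ?posrE//; lra.
by apply/eqP => e; move: h; rewrite e cnorm0; lra.
Qed.

Lemma log_single_layer r r1 z0 z w : 0 < r -> r < r1 -> r1 <= cdist w z0 ->
  cdist z z0 < r ->
  ln (cdist z w) = ln (cdist z0 w) +
    cint (fun t => nker r z0 w t * ln (cdist z (z0 + circ r t))).
Proof.
move=> r0 rr1 r1w zr.
have [[g hf] hh] := log_holo (r1w : r1 <= cnorm (w - z0)).
have := @single_layer _ _ _ _ _ (fun q => ln (cdist q (w - z0))) _ r0 rr1
  (zr : cnorm (z - z0) < r) hf hh.
have -> : cdist (z - z0) (w - z0) = cdist z w by rewrite !cdistE opprB addrA subrK.
have -> : cdist 0 (w - z0) = cdist z0 w by rewrite !cdistE sub0r opprB.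
move=> ->; congr (_ + _); apply: eq_cint => t; congr (_ * ln _).
by rewrite !cdistE opprD addrA.
Qed.

Lemma harmonic_single_layer (M : set C) (h : C -> R) z0 rho r z :
  harmonic_on M h -> Qdisc z0 rho `<=` M -> 0 < r -> r < rho ->
  cdist z z0 < r ->
  h z = h z0 + cint (fun t =>
    ndens r (fun q => (pd ex h (z0 + q), - pd ey h (z0 + q))) t *
    ln (cdist z (z0 + circ r t))).
Proof.
move=> hh DM r0 rr zr.
have [[g hf] hd] := harmonic_holo hh DM.
have := @single_layer _ _ _ _ _ (fun q => h (z0 + q)) _ r0 rr
  (zr : cnorm (z - z0) < r) hf hd.
rewrite addrC subrK addr0 => ->; congr (_ + _); apply: eq_cint => t.
by congr (_ * ln _); rewrite !cdistE opprD addrA.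
Qed.

Lemma circ_cdist_bounds r z0 z t : 0 < r -> cdist z z0 < r ->
  r - cdist z z0 <= cdist z (z0 + circ r t) <= r + cdist z z0.
Proof.
move=> r0 zr.
have e : cdist (z0 + circ r t) z0 = r.
  by rewrite cdistE (addrC z0) addrK cnorm_circ// ltW.
have := cdist_triangle (z0 + circ r t) z z0.
have := cdist_triangle z z0 (z0 + circ r t).
rewrite e (cdistC z0) e (cdistC (z0 + circ r t) z) => h1 h2.
by apply/andP; split; lra.
Qed.

Lemma ln_circ_bound r z0 z t : 0 < r -> cdist z z0 < r ->
  `|ln (cdist z (z0 + circ r t))| <=
  `|ln (r - cdist z z0)| + `|ln (r + cdist z z0)|.
Proof.
move=> r0 zr; have /andP[h1 h2] := circ_cdist_bounds t r0 zr.
by apply: ln_bound => //; rewrite subr_gt0.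
Qed.

Lemma ln_annulus_bound r1 B z0 z w : cdist z z0 < r1 -> r1 <= cdist w z0 ->
  cdist w z0 < B ->
  `|ln (cdist z w)| <= `|ln (r1 - cdist z z0)| + `|ln (B + cdist z z0)|.
Proof.
move=> zr r1w wB.
have := cdist_triangle w z z0; have := cdist_triangle z z0 w.
rewrite (cdistC w z) (cdistC z0 w) => h1 h2.
by apply: ln_bound; lra.
Qed.

Section far.
Variables (mu : {finite_measure set C -> \bar R}) (r r1 B : R) (z0 : C).
Hypotheses (r0 : 0 < r) (rr1 : r < r1).
Let F := Qdisc z0 B `\` Qdisc z0 r1.

Let mF : measurable F.
Proof. by apply: measurableD; exact: measurable_Qdisc. Qed.

Let F1 w : F w -> r1 <= cdist w z0.
Proof. by move=> [_]; rewrite /Qdisc/= => /negP; rewrite -leNgt. Qed.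

Let fF (A : set C) : measurable A -> (mu A < +oo)%E.
Proof. by move=> mA; rewrite ltey_eq fin_num_measure. Qed.

Let pi0 : 0 <= pi^-1 :> R. Proof. by rewrite invr_ge0 pi_ge0. Qed.

Let nkb w t : F w -> `|nker r z0 w t| <= pi^-1 * (r / (r1 - r)).
Proof.
move=> /F1 Fw; apply: (le_trans (nker_bound t r0 (lt_le_trans rr1 Fw))).
apply: ler_wpM2l => //; apply: ler_wpM2l; first exact: ltW.
have h1 : 0 < r1 - r by rewrite subr_gt0.
have h2 : r1 - r <= cdist w z0 - r by rewrite lerD2r.
by rewrite lef_pV2 ?posrE// (lt_le_trans h1).
Qed.

(** Superposition of the kernels of all [w] between the radii [r1] and [B]: the circle density that
    replaces this part of [mu]. *)
Definition fardens t : R := \int[mu]_(w in F) nker r z0 w t.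

Lemma measurable_fardens :
  measurable_fun (`[0, 2 * pi]%classic : set (measurableTypeR R)) fardens.
Proof.
apply: (@measurable_Rintegral _ _ _ (measurableTypeR R) C
  (@lebesgue_measure R) mu _ _ (fun p => nker r z0 p.2 p.1)
  (pi^-1 * (r / (r1 - r)))) => //.
- by rewrite /= lebesgue_measure_itv/= lte_fin twopi_gt0 -EFinD ltry.
- exact: fF.
- exact: measurable_nker.
- by move=> t w _ Fw; exact: nkb.
Qed.

(** [log_single_layer] is integrated in [w] and the integrals exchanged. The integrand is bounded,
    since [w] stays at distance at least [r1 - r] from the circle and [z] is strictly inside it. *)
Lemma far_potential z : cdist z z0 < r ->
  \int[mu]_(w in F) ln (cdist z w) = \int[mu]_(w in F) ln (cdist z0 w) +
    cint (fun t => fardens t * ln (cdist z (z0 + circ r t))).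
Proof.
move=> zr.
pose e t := ln (cdist z (z0 + circ r t)).
pose Ke := `|ln (r - cdist z z0)| + `|ln (r + cdist z z0)|.
have Ke0 : 0 <= Ke by rewrite addr_ge0.
pose K := pi^-1 * (r / (r1 - r)) * Ke.
have me : measurable_fun setT (e : measurableTypeR R -> R).
  apply: measurableT_comp; first exact: measurable_ln.
  apply: measurable_cdist2; first exact: measurable_cst.
  exact: measurable_shift_circ.
pose f (p : (measurableTypeR R * C)%type) := nker r z0 p.2 p.1 * e p.1.
have mf : measurable_fun setT f.
  apply: measurable_funM; first exact: measurable_nker.
  by apply: measurableT_comp => //; exact: measurable_fst.
have lf : (@lebesgue_measure R `[0%R, (2 * pi)%R]%classic < +oo)%E.
  by rewrite /= lebesgue_measure_itv/= lte_fin twopi_gt0 -EFinD ltry.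
have fK t w : `[0, 2 * pi]%classic t -> F w -> `|f (t, w)| <= K.
  move=> _ Fw; rewrite /f /= normrM /K; apply: ler_pM => //; first exact: nkb.
  exact: ln_circ_bound.
have H := @Rintegral_exchange _ _ _ (measurableTypeR R) C
  (@lebesgue_measure R) mu _ _ f K (measurable_itv _) mF lf (fF mF) mf fK.
have iz y : cdist y z0 < r -> mu.-integrable F (EFin \o (fun w => ln (cdist y w))).
  move=> yr; apply: (@bounded_integrable _ _ _ _ _ _
    (`|ln (r1 - cdist y z0)| + `|ln (B + cdist y z0)|)) => //.
  - exact: fF.
  - by apply: measurable_funTS; exact: measurable_ln_cdist.
  - move=> w Fw; apply: ln_annulus_bound; [exact: lt_trans rr1|exact: F1|].
    by have [] := Fw.
have z0r : cdist z0 z0 < r by rewrite cdistE subrr cnorm0.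
apply/eqP; rewrite addrC -subr_eq -RintegralB//; [|exact: iz|exact: iz].
apply/eqP; transitivity (\int[mu]_(w in F)
    \int[@lebesgue_measure R]_(t in `[0, 2 * pi]) f (t, w)).
  apply: eq_Rintegral => w /set_mem Fw.
  by rewrite (log_single_layer r0 rr1 (F1 Fw) zr) addrC addKr.
rewrite -H; apply: eq_Rintegral => t _.
rewrite /f /= /fardens RintegralZr//.
apply: (@bounded_integrable _ _ _ _ _ _ (pi^-1 * (r / (r1 - r)))) => //.
- exact: fF.
- apply: measurable_funTS.
  exact: measurable_nker1.
- by move=> w Fw; exact: nkb.
Qed.

(* Near [z0] the kernel is only bounded, but the punctured disc has small mass;
   away from [z0] it is of order [r]. *)
Lemma fardens_bound (rho : R) t : r * 2 <= rho ->
  `|fardens t| <= pi^-1 *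
    (r / (r1 - r) * fine (mu (Qdisc z0 rho `\ z0)) + 2 * r / rho * fine (mu setT)).
Proof.
have := rr1; have := r0 => r0' rr1' rrho.
have rho0 : 0 < rho by lra.
pose P := Qdisc z0 rho `\ z0.
have mP : measurable P.
  by apply: measurableD; [exact: measurable_Qdisc|exact: measurable_point].
have c0 : 0 <= r / (r1 - r) by rewrite divr_ge0//; lra.
have c1 : 0 <= 2 * r / rho by rewrite divr_ge0//; lra.
pose b w : R := pi^-1 * (r / (r1 - r)) * \1_P w + pi^-1 * (2 * r / rho).
have nb w : F w -> `|nker r z0 w t| <= b w.
  move=> Fw; rewrite /b indicE; case: (boolP (w \in P)) => [|/negP nP].
    move=> _; rewrite mulr1; apply: (le_trans (nkb t Fw)).
    by rewrite lerDl mulr_ge0.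
  rewrite mulr0 add0r.
  have Fw1 := F1 Fw.
  have wrho : rho <= cdist w z0.
    rewrite leNgt; apply/negP => h; apply: nP; rewrite inE; split => //=.
    by move=> e; move: Fw1; rewrite e cdistE subrr cnorm0; lra.
  apply: (le_trans (nker_bound t r0 (lt_le_trans rr1 Fw1))).
  rewrite ler_wpM2l//.
  (* From [cdist w z0 >= rho >= 2 r] one gets [cdist w z0 - r >= rho / 2]. *)
  rewrite ler_pdivrMr; last lra.
  rewrite mulrAC ler_pdivlMr//; nra.
have mb : measurable_fun setT b.
  by apply: measurable_funD => //; apply: measurable_funM => //; exact: measurable_indic.
have b0 w : 0 <= b w.
  have i0 : 0 <= \1_P w :> R by rewrite indicE; case: (w \in P).
  by apply: addr_ge0; apply: mulr_ge0 => //; exact: mulr_ge0.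
have bb w : `|b w| <= pi^-1 * (r / (r1 - r)) + pi^-1 * (2 * r / rho).
  rewrite ger0_norm// /b lerD2r indicE; case: (w \in P); rewrite ?mulr1// mulr0.
  by rewrite mulr_ge0.
have ib A : measurable A -> mu.-integrable A (EFin \o b).
  move=> mA; apply: (@bounded_integrable _ _ _ _ _ _
    (pi^-1 * (r / (r1 - r)) + pi^-1 * (2 * r / rho))) => //; first exact: fF.
  exact: measurable_funTS.
have ik : mu.-integrable F (EFin \o (nker r z0 ^~ t)).
  apply: (@bounded_integrable _ _ _ _ _ _ (pi^-1 * (r / (r1 - r)))) => //.
  - exact: fF.
  - apply: measurable_funTS.
    exact: measurable_nker1.
  - by move=> w Fw; exact: nkb.
apply: (le_trans (le_normr_Rintegral mF ik)).
have ika : mu.-integrable F (EFin \o (fun w => `|nker r z0 w t|)).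
  exact: integrable_norm.
apply: (le_trans (le_Rintegral mF ika (ib _ mF) nb)).
have le_T : \int[mu]_(w in F) b w <= \int[mu]_w b w.
  rewrite /Rintegral fine_le//; [exact: integrable_fin_num (ib _ mF)|
    exact: integrable_fin_num (ib _ measurableT)|].
  apply: ge0_subset_integral => //.
  - exact/measurable_EFinP.
  - by move=> w _; rewrite lee_fin.
apply: (le_trans le_T).
have ii : mu.-integrable setT (EFin \o (\1_P : C -> R)).
  apply: (@bounded_integrable _ _ _ _ _ _ 1) => //; first exact: fF.
  by move=> w _; rewrite ger0_norm indicE//; case: (w \in P).
have i1 : mu.-integrable setT
    (EFin \o (fun w => pi^-1 * (r / (r1 - r)) * \1_P w)).
  exact: (integrableZl measurableT _ ii).
have i2 : mu.-integrable setT (EFin \o (fun=> pi^-1 * (2 * r / rho))).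
  apply: (@bounded_integrable _ _ _ _ _ _ (pi^-1 * (2 * r / rho))) => //.
    exact: fF.
  by move=> w _; rewrite ger0_norm// mulr_ge0.
rewrite (RintegralD measurableT i1 i2) (RintegralZl _ measurableT ii).
rewrite Rintegral_cst// /Rintegral integral_indic// setIT.
by rewrite mulrDr !mulrA.
Qed.

End far.

End log_potential.

(** * Charges on a circle, small masses, and the splitting of potentials *)

Section sweeping.
Context {R : realType}.
Local Notation C := (R * R)%type.
Local Notation lam := (@lebesgue_measure R).
Implicit Types z w : C.

Lemma cint_bounded_integrable (f : R -> R) (K : R) :
  measurable_fun (`[0, 2 * pi]%classic : set (measurableTypeR R)) f ->
  (forall t, `|f t| <= K) -> lam.-integrable `[0, 2 * pi] (EFin \o f).
Proof.
move=> mf fK; apply: (@bounded_integrable _ _ _ _ _ _ K) => //.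
by rewrite /= lebesgue_measure_itv/= lte_fin twopi_gt0 -EFinD ltry.
Qed.

(** The measures have the nonnegative densities [g + ka] and [ka]. The constant cancels in the
    difference, which is therefore bounded by [2 pi ka] on every measurable set. *)
Lemma circle_charge (r : R) z0 (g : R -> R) (ka : R) :
  measurable_fun (`[0, 2 * pi]%classic : set (measurableTypeR R)) g ->
  (forall t, `|g t| <= ka) ->
  exists s1 s2 : {finite_measure set C -> \bar R}, [/\
    forall A, (forall t, ~ A (z0 + circ r t)) -> s1 A = 0%E /\ s2 A = 0%E,
    forall A, measurable A -> (`|s1 A - s2 A| <= (ka * (2 * pi))%:E)%E &
    forall (E : set C) (f : C -> R) (K : R), measurable E ->
      (forall t, E (z0 + circ r t)) -> measurable_fun E f ->
      (forall w, E w -> `|f w| <= K) ->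
      \int[s1]_(w in E) f w - \int[s2]_(w in E) f w =
      cint (fun t => g t * f (z0 + circ r t))].
Proof.
move=> mg gka.
have ka0 : 0 <= ka by apply: le_trans (gka 0); exact: normr_ge0.
pose I : set (measurableTypeR R) := `[0, 2 * pi]%classic.
have mI : measurable I by exact: measurable_itv.
(* The densities are cut off to one period, because [wpush] integrates over the whole line, where
   the circle is covered infinitely often. *)
pose G1 := (fun t => g t + ka) \_ I; pose G2 := (fun _ : R => ka) \_ I.
have ig : lam.-integrable I (EFin \o g) by exact: cint_bounded_integrable gka.
have ik : lam.-integrable I (EFin \o (fun=> ka)).
  by apply: (@cint_bounded_integrable _ ka) => // t; rewrite ger0_norm.
have igk : lam.-integrable I (EFin \o (fun t => g t + ka)).
  apply: (@cint_bounded_integrable _ (ka + ka)).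
    exact: measurable_funD.
  by move=> t; apply: (le_trans (ler_normD _ _)); rewrite lerD// ger0_norm.
have G10 t : 0 <= G1 t.
  rewrite /G1 patchE; case: ifP => // _.
  by have := gka t; rewrite ler_norml => /andP[? _]; lra.
have G20 t : 0 <= G2 t by rewrite /G2 patchE; case: ifP.
have iG1 : lam.-integrable setT (EFin \o G1).
  by move/(integrable_mkcond _ mI): igk; rewrite -restrict_EFin.
have iG2 : lam.-integrable setT (EFin \o G2).
  by move/(integrable_mkcond _ mI): ik; rewrite -restrict_EFin.
have mw := measurable_shift_circ r z0.
have mpre (A : set C) : measurable A ->
    measurable ((fun t => z0 + circ r t) @^-1` A : set (measurableTypeR R)).
  by move=> mA; rewrite -[X in measurable X]setTI; exact: mw.
exists (wpush mw G10 iG1), (wpush mw G20 iG2); split.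
- move=> A nA; rewrite /= /wpush.
  have -> : ((fun t => z0 + circ r t) @^-1` A : set (measurableTypeR R)) = set0.
    by apply/seteqP; split => t //= /nA.
  by rewrite !integral_set0.
- move=> A mA; rewrite /= /wpush.
  set A' := _ @^-1` A; have mA' : measurable A' := mpre _ mA.
  have e G : (\int[lam]_(x in A') ((G \_ I) x)%:E =
      \int[lam]_(x in A' `&` I) (G x)%:E)%E.
    by rewrite integral_mkcondr; apply: eq_integral => x _; rewrite restrict_EFin.
  rewrite !e; have mAI : measurable (A' `&` I) by exact: measurableI.
  have sI : A' `&` I `<=` I by move=> x [].
  have igA := integrableS mI mAI sI ig.
  rewrite -integralB_EFin//; [|exact: integrableS igk|exact: integrableS ik].
  under eq_integral do rewrite -EFinB addrK.
  apply: (le_trans (le_abse_integral _ mAI _)); first exact: measurable_int igA.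
  apply: (@le_trans _ _ (\int[lam]_(x in A' `&` I) ka%:E)%E).
    apply: ge0_le_integral => //.
    + by apply: measurableT_comp => //; exact: measurable_int igA.
    + by move=> x _; rewrite lee_fin; exact: gka.
  rewrite integral_cst// EFinM lee_wpmul2l// ?lee_fin//.
  apply: (@le_trans _ _ (lam I)); first by apply: le_measure; rewrite ?inE.
  by rewrite /= lebesgue_measure_itv/= lte_fin twopi_gt0 -EFinD subr0.
- move=> E f K mE Ew mf fK.
  rewrite !(@Rintegral_wpush _ _ _ _ _ _ _ _ _ _ _ _ _ K)//.
  have -> : ((fun t => z0 + circ r t) @^-1` E : set (measurableTypeR R)) = setT.
    by apply/seteqP; split => t //= _; exact: Ew.
  have mfw : measurable_fun setT ((fun t => f (z0 + circ r t)) : measurableTypeR R -> R).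
    by apply: (measurable_comp mE _ mf mw) => _ [t _ <-]; exact: Ew.
  have e G : \int[lam]_x (f (z0 + circ r x) * (G \_ I) x) =
      \int[lam]_(x in I) (f (z0 + circ r x) * G x).
    rewrite [RHS]Rintegral_mkcond; apply: eq_Rintegral => x _; rewrite !patchE.
    by case: ifP => //; rewrite mulr0.
  rewrite !e -RintegralB//.
  + by apply: eq_Rintegral => x _; ring.
  + apply: (@cint_bounded_integrable _ (K * (ka + ka))).
      apply: measurable_funM; first exact: measurable_funTS.
      exact: measurable_funD.
    move=> t; rewrite normrM; apply: ler_pM => //; first exact: fK.
    by apply: (le_trans (ler_normD _ _)); rewrite lerD// ger0_norm.
  + apply: (@cint_bounded_integrable _ (K * ka)).
      by apply: measurable_funM => //; exact: measurable_funTS.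
    by move=> t; rewrite normrM; apply: ler_pM => //; [exact: fK|rewrite ger0_norm].
Qed.

(** Without their centre, where [mu] may have an atom, the discs decrease to the empty set;
    continuity from above concludes. *)
Lemma small_punctured_disc (mu : {finite_measure set C -> \bar R}) z0 (e : R) :
  0 < e -> exists2 rho, 0 < rho &
    forall s, s <= rho -> fine (mu (Qdisc z0 s `\ z0)) < e.
Proof.
move=> e0.
pose F n := Qdisc z0 (n.+1%:R^-1) `\ z0.
have mQ s : measurable (Qdisc z0 s `\ z0).
  by apply: measurableD; [exact: measurable_Qdisc|exact: measurable_point].
have mF n : measurable (F n) by exact: mQ.
have F0 : \bigcap_n F n = set0.
  apply/seteqP; split => w //= H.
  have [_ /= wz] := H 0%N I.
  have d0 : 0 < cdist w z0.
    rewrite lt_def -[cdist w z0]/(cnorm (w - z0)) cnorm_ge0 andbT.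
    by rewrite cnorm_eq0 subr_eq0; apply/eqP.
  have [n /= hn] := ltr_add_invr (d0 : 0 < cdist w z0).
  have [hw _] := H n I; move: hw; rewrite /Qdisc/=.
  by rewrite add0r in hn; rewrite ltNge (ltW hn).
have cv : mu (F n) @[n --> \oo] --> mu (\bigcap_n F n).
  apply: nonincreasing_cvg_mu => //.
  - by rewrite ltey_eq fin_num_measure.
  - by rewrite F0.
  - move=> n m nm; rewrite subsetEset => w [/= hw wz]; split => //.
    apply: (lt_le_trans hw); rewrite lef_pV2 ?posrE ?ltr0n// ler_nat ltnS//.
rewrite F0 measure0 in cv.
have [n _ hn] : \forall n \near \oo, (mu (F n) < e%:E)%E.
  by move/fine_cvgP: cv => [_ /cvgrPdist_lt/(_ e e0)] H;
    apply: filterS H => n /=; rewrite sub0r normrN ger0_norm ?fine_ge0// => h;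
    rewrite -(fineK (fin_num_measure mu _ (mF n))) lte_fin.
exists (n.+1%:R^-1); first by rewrite invr_gt0 ltr0n.
move=> s sn; rewrite -lte_fin fineK ?fin_num_measure//.
apply: le_lt_trans (hn n (leqnn n)); apply: le_measure; rewrite ?inE//.
by move=> w [hw wz]; split => //; exact: lt_le_trans sn.
Qed.

Lemma compact_support_disc (om : {charge set C -> \bar R}) z0 :
  compact_support om -> exists B0 : R, forall B A, B0 <= B -> measurable A ->
    A `<=` ~` Qdisc z0 B -> om A = 0%E.
Proof.
move=> [K [cK hK]].
have cD : {within K, continuous (cdist z0)}.
  by apply: continuous_subspaceT; exact: continuous_cdist.
have /compact_bounded[M [_ mrt]] := continuous_compact cD cK.
(* [mrt] bounds the distance on [K] by [M + 1]; one more unit makes the inequality strict, as the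
   open disc requires. *)
exists (M + 2) => B A B0 mA AB; apply: hK => //.
apply/seteqP; split => w //= -[Aw Kw]; apply: (AB w Aw).
rewrite /Qdisc/= cdistC.
have := mrt (M + 1); rewrite ltrDl ltr01 => /(_ isT) /(_ (cdist z0 w)) /=.
move=> /(_ (ex_intro2 _ _ w Kw erefl)) h.
by apply: le_lt_trans (ler_norm _) _; lra.
Qed.

Lemma jordan_support (om : {charge set C -> \bar R}) (S : set C) :
  measurable S -> (forall A, measurable A -> A `<=` S -> om A = 0%E) ->
  jpos om S = 0%E /\ jneg om S = 0%E.
Proof.
move=> mS H; have [[mP _] [mN _] _ _] := hahn_PNP om.
by rewrite jposE// jnegE// !H ?oppe0//; try exact: measurableI; move=> x [].
Qed.

(** As [z] is in the disc of radius [r], the logarithm is bounded on the ring. Only the inner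
    integral can be infinite, and never [+oo], since the kernel is bounded above there. *)
Lemma potential_split (mu : {finite_measure set C -> \bar R}) r b z0 z :
  0 < r -> r <= b -> cdist z z0 < r -> mu (~` Qdisc z0 b) = 0%E ->
  (\int[mu]_w lnk z w = \int[mu]_(w in Qdisc z0 r) lnk z w +
    (\int[mu]_(w in Qdisc z0 b `\` Qdisc z0 r) ln (cdist z w))%:E)%E /\
  (\int[mu]_(w in Qdisc z0 r) lnk z w < +oo)%E.
Proof.
move=> r0 rb zr N0.
pose E := Qdisc z0 b `\` Qdisc z0 r.
have mD := measurable_Qdisc (R := R) z0 r.
have mE : measurable E by apply: measurableD; exact: measurable_Qdisc.
have fin A : measurable A -> (mu A < +oo)%E.
  by move=> mA; rewrite ltey_eq fin_num_measure.
have lE w : E w -> lnk z w = (ln (cdist z w))%:E.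
  move=> [_ nw]; rewrite /lnk; case: eqP => // e.
  by exfalso; apply: nw; rewrite -e.
have iE : mu.-integrable E (EFin \o (fun w => ln (cdist z w))).
  apply: (@bounded_integrable _ _ _ _ _ _
    (`|ln (r - cdist z z0)| + `|ln (b + cdist z z0)|)) => //.
  - exact: fin.
  - by apply: measurable_funTS; exact: measurable_ln_cdist.
  - move=> w [wb /negP wr]; apply: ln_annulus_bound => //.
    by rewrite leNgt.
have iE' : mu.-integrable E (lnk z).
  by apply: (eq_integrable mE _ _ _ iE) => w /set_mem Ew; rewrite lE.
have Dfin : (\int[mu]_(w in Qdisc z0 r) (lnk z)^\+ w < +oo)%E.
  pose K := `|ln (r + r)|.
  apply: (@le_lt_trans _ _ (\int[mu]_(w in Qdisc z0 r) K%:E)%E).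
    apply: ge0_le_integral => //.
    - by apply: measurable_funepos; apply: measurable_funTS; exact: measurable_lnk.
    - move=> w; rewrite /Qdisc/= => wr; rewrite funeposE ge_max lee_fin normr_ge0 andbT.
      rewrite /lnk; case: eqP => [_|/eqP zw]; first exact: leNye.
      rewrite lee_fin; apply: le_trans (ler_norm _).
      have d0 : 0 < cdist z w.
        by rewrite lt_def cdist_eq0 zw -[cdist z w]/(cnorm (z - w)) cnorm_ge0.
      have dr : cdist z w <= r + r.
        have := cdist_triangle z z0 w; rewrite (cdistC z0 w); lra.
      by rewrite ler_ln ?posrE//; exact: lt_le_trans dr.
  rewrite integral_cst//; apply: lte_mul_pinfty; [by rewrite lee_fin normr_ge0|by []|exact: fin].
have sub : Qdisc z0 r `|` E = Qdisc z0 b.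
  apply/seteqP; split => w.
    by move=> [|[]//]; rewrite /Qdisc/= => h; exact: lt_le_trans rb.
  by move=> wb; have [wr|nwr] := pselect (Qdisc z0 r w); [left|right].
have [||e1 e2] := integral_split mD mE _ _ (measurable_lnk z) Dfin iE'.
- by rewrite /E setDIK.
- by rewrite sub.
split => //; rewrite e1; congr (_ + _)%E.
rewrite /Rintegral fineK; last exact: integrable_fin_num iE.
by apply: eq_integral => w /set_mem Ew; rewrite lE.
Qed.

(** [a] and [b] are the inner integrals, common to both sides. If exactly one is [-oo], both sides
    are the same infinity; [-oo] for both is excluded where the potential is defined. *)
Lemma spot_arith (ki : R) (a b : \bar R) (p q p' q' h k : R) : 0 < ki ->
  (a < +oo -> b < +oo ->
  ~ (ki%:E * (a + p%:E) = -oo /\ ki%:E * (b + q%:E) = -oo))%E ->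
  ki * (p - q) + h = ki * (p' - q') + k ->
  (a < +oo)%E -> (b < +oo)%E ->
  (ki%:E * (a + p%:E) - ki%:E * (b + q%:E) + h%:E =
   ki%:E * (a + p'%:E) - ki%:E * (b + q'%:E) + 0%:E + k%:E)%E.
Proof.
move=> k0 + + afin bfin => /(_ afin bfin) nd e.
case: a b afin bfin nd => [a| |] [b| |]// _ _ nd.
- rewrite -!EFinD; congr EFin.
  have -> : ki * (a + p) - ki * (b + q) + h =
    ki * a - ki * b + (ki * (p - q) + h) by ring.
  by rewrite e; ring.
- by rewrite /= mulrNy gtr0_sg// mul1e.
- by rewrite /= mulrNy gtr0_sg// mul1e.
- by exfalso; apply: nd; rewrite /= mulrNy gtr0_sg// mul1e.
Qed.

End sweeping.

(** * Comparison of the potentials before and after sweeping *)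

Section swept_charge.
Context {R : realType}.
Local Notation C := (R * R)%type.

Lemma fin_num_cancel (a b c d : \bar R) : a \is a fin_num -> b \is a fin_num ->
  c \is a fin_num -> d \is a fin_num ->
  (a - b + (c - d) + (b + d) = a + c)%E.
Proof.
move=> /fineK <- /fineK <- /fineK <- /fineK <-.
by rewrite -!EFinD; congr EFin; ring.
Qed.

(** [Ep], [En] are integrals over the ring, [Lp], [Ln] the outer ones taken at [z0], [Ip], [In]
    their circle terms, and [J] the circle term of [h], the only one to carry [tp = 2 pi]. *)
Lemma sweep_arith (ki tp Ep En Lp Ln Ip In J h0 : R) : ki * tp = 1 ->
  ki * (Ep + (Lp + Ip) - (En + (Ln + In))) + (h0 + J) =
  ki * (Ep - En + (tp * J + (Ip - In))) + (h0 + ki * (Lp - Ln)).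
Proof.
move=> kt; apply/eqP; rewrite -subr_eq0; apply/eqP.
by transitivity ((1 - ki * tp) * J); [ring|rewrite kt subrr mul0r].
Qed.

(** On the disc of radius [r] the two charges coincide, hence so do their Jordan parts and the
    possibly infinite integrals. What remains is real: the circle charge restores what was removed,
    up to the values at [z0]. *)
Lemma swept_potential (M : set C) (h : C -> R) (omega omt : {charge set C -> \bar R})
    (s1 s2 : {finite_measure set C -> \bar R}) (z0 : C) (rho r r1 B : R) :
  harmonic_on M h -> Qdisc z0 rho `<=` M -> 0 < r -> r < rho -> r < r1 -> r1 <= B ->
  (forall A, measurable A -> A `<=` ~` Qdisc z0 B -> omega A = 0%E) ->
  (forall A, (forall t, ~ A (z0 + circ r t)) -> s1 A = 0%E /\ s2 A = 0%E) ->
  (forall A, measurable A ->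
     omt A = omega (A `&` Qdisc z0 r1) + (s1 A - s2 A))%E ->
  let f q := (pd ex h (z0 + q), - pd ey h (z0 + q)) in
  let g t := 2 * pi * ndens r f t +
    (fardens (jpos omega) r r1 B z0 t - fardens (jneg omega) r r1 B z0 t) in
  let F := Qdisc z0 B `\` Qdisc z0 r1 in
  (forall (E : set C) (e : C -> R) (K : R), measurable E ->
      (forall t, E (z0 + circ r t)) -> measurable_fun E e ->
      (forall w, E w -> `|e w| <= K) ->
      \int[s1]_(w in E) e w - \int[s2]_(w in E) e w =
      cint (fun t => g t * e (z0 + circ r t))) ->
  (exists ka, forall t, `|ndens r f t| <= ka /\
     `|fardens (jpos omega) r r1 B z0 t| <= ka /\
     `|fardens (jneg omega) r r1 B z0 t| <= ka) ->
  continuous (ndens r f) ->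
  forall z, cdist z z0 < r -> spot_defined omega z ->
  spot omega h z = (spot omt (fun=> 0%R) z +
    (h z0 + (2 * pi)^-1 * (\int[jpos omega]_(w in F) ln (cdist z0 w) -
      \int[jneg omega]_(w in F) ln (cdist z0 w)))%:E)%E.
Proof.
move=> hh DM r0 rrho rr1 r1B supp circ0 omtE f g F intg [ka kab] cnd z zr defz.
have mQ s : measurable (Qdisc z0 s) by exact: measurable_Qdisc.
have mQD s s' : measurable (Qdisc z0 s `\` Qdisc z0 s') by exact: measurableD.
have rB : r <= B by lra.
have Dcirc t : cdist (z0 + circ r t) z0 = r.
  by rewrite cdistE (addrC z0) addrK cnorm_circ// ltW.
have agree A : measurable A -> A `<=` Qdisc z0 r -> omt A = omega A.
  move=> mA AD; rewrite omtE// setIidl; last first.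
    by move=> w /AD h1; exact: lt_trans rr1.
  have [|-> ->] := circ0 A; last by rewrite sube0 adde0.
  by move=> t /AD; rewrite /Qdisc/= Dcirc ltxx.
have omt0 A : measurable A -> A `<=` ~` Qdisc z0 r1 -> omt A = 0%E.
  move=> mA AD; rewrite omtE// (_ : A `&` _ = set0); last first.
    by apply/seteqP; split => w //= -[/AD].
  rewrite charge0; have [|-> ->] := circ0 A; last by rewrite sube0 adde0.
  by move=> t /AD; apply; rewrite /Qdisc/= Dcirc.
have [sp sn] := jordan_support (measurableC (mQ B)) supp.
have [tp tn] := jordan_support (measurableC (mQ r1)) omt0.
have [ep fp] := @potential_split R (jpos omega) _ _ _ _ r0 rB zr sp.
have [en fn] := @potential_split R (jneg omega) _ _ _ _ r0 rB zr sn.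
have [ep' _] := @potential_split R (jpos omt) _ _ _ _ r0 (ltW rr1) zr tp.
have [en' _] := @potential_split R (jneg omt) _ _ _ _ r0 (ltW rr1) zr tn.
have Jp : (\int[jpos omt]_(w in Qdisc z0 r) lnk z w =
           \int[jpos omega]_(w in Qdisc z0 r) lnk z w)%E.
  apply: eq_measure_integral => A mA AD.
  by have [] := jordan_local (mQ r) agree mA AD.
have Jn : (\int[jneg omt]_(w in Qdisc z0 r) lnk z w =
           \int[jneg omega]_(w in Qdisc z0 r) lnk z w)%E.
  apply: eq_measure_integral => A mA AD.
  by have [] := jordan_local (mQ r) agree mA AD.
have ki0 : 0 < (2 * pi)^-1 :> R by rewrite invr_gt0 twopi_gt0.
pose e w := ln (cdist z w).
pose E1 := Qdisc z0 r1 `\` Qdisc z0 r.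
have me (A : set C) : measurable_fun A e.
  by apply: measurable_funTS; exact: measurable_ln_cdist.
have eE b w : (Qdisc z0 b `\` Qdisc z0 r) w ->
    `|e w| <= `|ln (r - cdist z z0)| + `|ln (b + cdist z z0)|.
  by move=> [wb /negP wr]; apply: ln_annulus_bound => //; rewrite leNgt.
have fin (mu : {finite_measure set C -> \bar R}) A : measurable A -> (mu A < +oo)%E.
  by move=> mA; rewrite ltey_eq fin_num_measure.
have ie (mu : {finite_measure set C -> \bar R}) b :
    mu.-integrable (Qdisc z0 b `\` Qdisc z0 r) (EFin \o e).
  by apply: (@bounded_integrable _ _ _ _ _ _ _ (mQD b r) (fin mu _ (mQD b r)) (me _) (@eE b)).
have EU : Qdisc z0 B `\` Qdisc z0 r = E1 `|` F.
  apply/seteqP; split => w.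
    move=> [wB wr]; have [w1|w1] := pselect (Qdisc z0 r1 w); [left|right] => //.
  move=> [[w1 wr]|[wB w1]]; split => //; first exact: lt_le_trans r1B.
  by apply: contra_not w1 => wr; exact: lt_trans rr1.
have split_mu (mu : {finite_measure set C -> \bar R}) :
    \int[mu]_(w in Qdisc z0 B `\` Qdisc z0 r) e w =
    \int[mu]_(w in E1) e w + \int[mu]_(w in F) e w.
  have iU : mu.-integrable (E1 `|` F) (EFin \o e) by rewrite -EU; exact: ie.
  rewrite EU; apply: (Rintegral_setU (mQD r1 r) (mQD B r1) iU).
  by apply/disj_setPS => w [[w1 _] [_ nw1]].
have far (mu : {finite_measure set C -> \bar R}) :
    \int[mu]_(w in F) e w = \int[mu]_(w in F) ln (cdist z0 w) +
    cint (fun t => fardens mu r r1 B z0 t * e (z0 + circ r t)).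
  exact: far_potential.
(* The ring [E1] contains the circle, the inner disc being open. There [omt] is
   [(jpos omega + s1) - (jneg omega + s2)], in general not a Jordan decomposition. *)
have near_omt : \int[jpos omt]_(w in E1) e w - \int[jneg omt]_(w in E1) e w =
    \int[jpos omega]_(w in E1) e w - \int[jneg omega]_(w in E1) e w +
    cint (fun t => g t * e (z0 + circ r t)).
  have mE1 : measurable E1 by exact: mQD.
  rewrite -(intg E1 e _ mE1 _ (me _) (@eE r1)); last first.
    by move=> t; split; rewrite /Qdisc/= Dcirc// ltxx.
  have a1 : (measure_add (jpos omega) s1 E1 < +oo)%E.
    by rewrite measure_addE lte_add_pinfty// ?fin// ltey_eq jpos_fin.
  have a2 : (measure_add (jneg omega) s2 E1 < +oo)%E.
    by rewrite measure_addE lte_add_pinfty// ?fin// ltey_eq jneg_fin.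
  rewrite (@Rintegral_jordan _ _ _ omt (measure_add (jpos omega) s1)
    (measure_add (jneg omega) s2) E1 e _ mE1 a1 a2 _ (me _) (@eE r1)); last first.
    move=> A mA AE.
    transitivity (omt A + (jneg omega A + s2 A))%E.
      by congr (_ + _)%E; exact: measure_addE.
    transitivity (jpos omega A + s1 A)%E; last exact/esym/measure_addE.
    rewrite omtE// setIidl; last by move=> w /AE[].
    rewrite (chargeE omega mA).
    apply: fin_num_cancel.
    - exact: jpos_fin.
    - exact: jneg_fin.
    - exact: fin_num_measure.
    - exact: fin_num_measure.
  have add_int (m : {finite_measure set C -> \bar R}) (s : {finite_measure set C -> \bar R}) :
      \int[measure_add m s]_(w in E1) e w =
      \int[m]_(w in E1) e w + \int[s]_(w in E1) e w.
    have im := ie m r1; have is_ := ie s r1.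
    rewrite /Rintegral (integral_measure_add mE1 im is_).
    by rewrite (fineD (integrable_fin_num mE1 im) (integrable_fin_num mE1 is_)).
  by rewrite (add_int (jpos omega) s1) (add_int (jneg omega) s2); ring.
have cintg : cint (fun t => g t * e (z0 + circ r t)) =
    2 * pi * cint (fun t => ndens r f t * e (z0 + circ r t)) +
    (cint (fun t => fardens (jpos omega) r r1 B z0 t * e (z0 + circ r t)) -
     cint (fun t => fardens (jneg omega) r r1 B z0 t * e (z0 + circ r t))).
  pose Ke := `|ln (r - cdist z z0)| + `|ln (r + cdist z z0)|.
  have mew : measurable_fun (`[0, 2 * pi]%classic : set (measurableTypeR R))
      (fun t => e (z0 + circ r t)).
    apply: measurable_funTS.
    exact: (measurableT_comp (measurable_ln_cdist z) (measurable_shift_circ r z0)).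
  have mI : measurable (`[0, 2 * pi]%classic : set (measurableTypeR R)).
    exact: measurable_itv.
  have ii (u : R -> R) :
      measurable_fun (`[0, 2 * pi]%classic : set (measurableTypeR R)) u ->
      (forall t, `|u t| <= ka) ->
      (@lebesgue_measure R).-integrable `[0, 2 * pi]
        (EFin \o (fun t => u t * e (z0 + circ r t))).
    move=> mu uka; apply: (@cint_bounded_integrable _ _ (ka * Ke)).
      exact: measurable_funM.
    by move=> t; rewrite normrM; apply: ler_pM => //; exact: ln_circ_bound.
  have i1 : (@lebesgue_measure R).-integrable `[0, 2 * pi]
      (EFin \o (fun t => ndens r f t * e (z0 + circ r t))).
    apply: ii; last by move=> t; have [] := kab t.
    apply: measurable_funTS; exact: continuous_measurable_fun.
  have i2 : (@lebesgue_measure R).-integrable `[0, 2 * pi]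
      (EFin \o (fun t => fardens (jpos omega) r r1 B z0 t * e (z0 + circ r t))).
    apply: ii; last by move=> t; have [_ []] := kab t.
    exact: measurable_fardens.
  have i3 : (@lebesgue_measure R).-integrable `[0, 2 * pi]
      (EFin \o (fun t => fardens (jneg omega) r r1 B z0 t * e (z0 + circ r t))).
    apply: ii; last by move=> t; have [_ []] := kab t.
    exact: measurable_fardens.
  rewrite /cint -(RintegralZl _ mI i1) -(RintegralB mI i2 i3) -RintegralD//.
  - by apply: eq_Rintegral => t _; rewrite /g; ring.
  - exact: (integrableZl mI _ i1).
  - have := integrableB mI i2 i3; apply: eq_integrable => //.
rewrite /spot /pot ep en ep' en' Jp Jn.
apply: spot_arith => //.
  move=> _ _ [d1 d2]; apply: defz; rewrite /pot.
  by split; [rewrite ep|rewrite en].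
rewrite (harmonic_single_layer hh DM r0 rrho zr) -/f near_omt cintg.
rewrite (split_mu (jpos omega)) (split_mu (jneg omega)) !far.
by apply: sweep_arith; rewrite mulVf// gt_eqF// twopi_gt0.
Qed.

End swept_charge.

(** * Choice of the radii and estimate of the total variation *)

Section radii.
Context {R : realType}.
Local Notation C := (R * R)%type.

Lemma open_Qdisc_sub (M : set C) z0 : open M -> M z0 ->
  exists2 rho, 0 < rho & Qdisc z0 rho `<=` M.
Proof.
move=> oM Mz0.
have [d /= d0 H] := (nbhs_ballP _ _).1 (open_nbhs_nbhs (conj oM Mz0)).
exists d => // w wd; apply: H.
have w1 : `|z0.1 - w.1| < d.
  by rewrite distrC; exact: le_lt_trans (normr_fst_le (w - z0)) wd.
have w2 : `|z0.2 - w.2| < d.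
  by rewrite distrC; exact: le_lt_trans (normr_snd_le (w - z0)) wd.
by split.
Qed.

Lemma holo_bounded (rho s : R) (f g : C -> C) : s < rho -> holo (Qdisc 0 rho) f g ->
  exists2 K, 0 <= K & forall q, cnorm q <= s -> cnorm (f q) <= K.
Proof.
move=> srho hf.
have [K1 K10 bK1] := @continuous_bounded_disc R 0 s (fun p => (f p).1)
  (fun p pr => continuous_fst_at (let: And3 c _ _ := hf p
    (le_lt_trans pr srho) in c)).
have [K2 K20 bK2] := @continuous_bounded_disc R 0 s (fun p => (f p).2)
  (fun p pr => continuous_snd_at (let: And3 c _ _ := hf p
    (le_lt_trans pr srho) in c)).
exists (K1 + K2) => [|q qs]; first exact: addr_ge0.
apply: (le_trans (cnorm_le_sum _)).
by apply: lerD; [apply: bK1|apply: bK2]; rewrite cdist0.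
Qed.

Lemma closure_Qdisc (z0 : C) r : closure (Qdisc z0 r) `<=` [set w | cdist w z0 <= r].
Proof.
rewrite closureE => w /(_ [set w | cdist w z0 <= r]); apply.
by split; [exact: closed_disc|move=> x; rewrite /Qdisc/= => /ltW].
Qed.

(** Division by [X + 1] covers [X = 0]. In the application [r1 < 2 r] and [delta * (1 + eta) < 3 r],
    so the first two bounds give [r1 <= rho0] and put the closed outer disc in [M]. *)
Lemma small_radius (a b c X : R) : 0 < a -> 0 < b -> 0 < c -> 0 <= X ->
  exists r, [/\ 0 < r, r * 2 <= a, r * 6 <= b & X * r <= c].
Proof.
move=> a0 b0 c0 X0.
have X1 : 0 < X + 1 by lra.
exists (Num.min (a / 2) (Num.min (b / 6) (c / (X + 1)))); split.
- by rewrite !lt_min !divr_gt0.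
- by rewrite -ler_pdivlMr// ge_min lexx.
- by rewrite -ler_pdivlMr// !ge_min lexx orbT.
- apply: (@le_trans _ _ (X * (c / (X + 1)))).
    by rewrite ler_wpM2l// !ge_min lexx !orbT.
  by rewrite mulrA ler_pdivrMr//; nra.
Qed.

End radii.

Theorem theorem3p31 (R : realType) (M : set (R * R)%type) (h : (R * R)%type -> R)
  (omega : {charge set (R * R)%type -> \bar R}) (z0 : (R * R)%type) (eps eta : R) :
  domain M -> harmonic_on M h -> compact_support omega -> M z0 ->
  0 < eps -> 0 < eta ->
  exists (delta : R) (k : R) (omt : {charge set (R * R)%type -> \bar R}),
    0 < delta /\
    [/\ closure (Qdisc z0 (delta * (1 + eta))) `<=` M,
        (forall A, measurable A -> A `<=` Qdisc z0 delta -> omt A = omega A),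
        (forall A, measurable A -> A `<=` ~` Qdisc z0 (delta * (1 + eta)) ->
           omt A = 0%E),
        (tvar omt (Qdisc z0 (delta * (1 + eta)) `\ z0) < eps%:E)%E
      & forall z, Qdisc z0 delta z -> spot_defined omega z -> spot_defined omt z ->
           spot omega h z = (spot omt (fun=> 0%R) z + k%:E)%E].
Proof.
move=> [oM _ _] hh cs Mz0 eps0 eta0.
have pi0 : 0 < pi :> R by exact: pi_gt0.
have [rhoM rhoM0 DM] := open_Qdisc_sub oM Mz0.
pose f q := (pd ex h (z0 + q), - pd ey h (z0 + q)).
have [[g hf] _] := harmonic_holo hh DM.
have hrho : rhoM / 2 < rhoM by lra.
have [Kh Kh0 bKh] := holo_bounded hrho hf.
have [B0 suppB0] := compact_support_disc z0 cs.
pose mp : {finite_measure set (R * R)%type -> \bar R} := jpos omega.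
pose mn : {finite_measure set (R * R)%type -> \bar R} := jneg omega.
(* The value of [r / (r1 - r)] for the radii defined below; it depends on [eta] alone and can be
   fixed before them. *)
pose c := 1 + 3 / eta.
have c0 : 0 < c by rewrite /c addr_gt0// divr_gt0.
(* Half of [eps] is spent on the masses [p] and [n], which enter the variation as
   [(1 + 4 * c) * (p + n)], and half on [X * r]. *)
pose e1 := eps / (4 * (1 + 4 * c)).
have c4 : 0 < 4 * (1 + 4 * c) by lra.
have e10 : 0 < e1 by rewrite divr_gt0.
have e1E : (1 + 4 * c) * (e1 + e1) = eps / 2 by rewrite /e1; field; rewrite gt_eqF//; lra.
have [rp rp0 hp] := small_punctured_disc mp z0 e10.
have [rn rn0 hn] := small_punctured_disc mn z0 e10.
pose rho0 := Num.min rp rn.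
have rho00 : 0 < rho0 by rewrite lt_min rp0.
pose p := fine (mp (Qdisc z0 rho0 `\ z0)).
pose n := fine (mn (Qdisc z0 rho0 `\ z0)).
have pe : p < e1 by apply: hp; rewrite ge_min lexx.
have ne : n < e1 by apply: hn; rewrite ge_min lexx orbT.
have p0 : 0 <= p by exact: fine_ge0.
have n0 : 0 <= n by exact: fine_ge0.
pose Sp := fine (mp setT); pose Sn := fine (mn setT).
have Sp0 : 0 <= Sp by exact: fine_ge0.
have Sn0 : 0 <= Sn by exact: fine_ge0.
(* The coefficient of [r] in twice [2 * pi * ka], where [ka] bounds the density on the circle; it
   has to be known before [r]. *)
pose X := 4 * pi * (2 * Kh + pi^-1 * (2 / rho0 * (Sp + Sn))).
have X0 : 0 <= X.
  have q0 : 0 <= 2 / rho0 * (Sp + Sn).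
    by apply: mulr_ge0; [apply: divr_ge0 => //; exact: ltW|exact: addr_ge0].
  have pv : 0 <= pi^-1 :> R by rewrite invr_ge0 ltW.
  apply: mulr_ge0; first by apply: mulr_ge0 => //; exact: ltW.
  by apply: addr_ge0; apply: mulr_ge0.
have eps20 : 0 < eps / 2 by lra.
have [r [r0 r2 r6 Xr]] := small_radius rho00 rhoM0 eps20 X0.
(* The radius of the circle is chosen first and [delta] is recovered from it. *)
pose delta := r / (1 + eta / 3).
have ed0 : 0 < 1 + eta / 3 by lra.
have delta0 : 0 < delta by rewrite divr_gt0.
have rE : r = delta * (1 + eta / 3) by rewrite /delta divfK// gt_eqF.
have de0 : 0 < delta * eta by rewrite mulr_gt0.
pose r1 := delta * (1 + 2 * eta / 3).
have r1E : r1 = delta + 2 * (delta * eta) / 3 by rewrite /r1; field.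
have rE' : r = delta + (delta * eta) / 3 by rewrite rE; field.
have dE : delta * (1 + eta) = delta + delta * eta by ring.
have dr : delta < r by lra.
have rr1 : r < r1 by lra.
have r1d : r1 < delta * (1 + eta) by lra.
have r1rho : r1 <= rho0 by lra.
have rcE : r / (r1 - r) = c.
  have -> : r1 - r = delta * eta / 3 by lra.
  by rewrite {1}rE /c; field; rewrite !gt_eqF.
pose B := Num.max B0 rho0.
have r1B : r1 <= B by rewrite le_max r1rho orbT.
have suppB A : measurable A -> A `<=` ~` Qdisc z0 B -> omega A = 0%E.
  by apply: suppB0; rewrite le_max lexx.
have rrhoM : r < rhoM by lra.
have mQ s : measurable (Qdisc z0 s) by exact: measurable_Qdisc.
have mQ0 s : measurable (Qdisc z0 s `\ z0).
  by apply: measurableD => //; exact: measurable_point.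
(* Potentials carry the factor [1 / (2 pi)] and [h] does not, hence the [2 * pi] on its density
   only. *)
pose gd t := 2 * pi * ndens r f t + (fardens mp r r1 B z0 t - fardens mn r r1 B z0 t).
have bnd t : `|ndens r f t| <= pi^-1 * (r * Kh).
  by apply: ndens_bound => //; apply: bKh; rewrite cnorm_circ; lra.
have bp t : `|fardens mp r r1 B z0 t| <= pi^-1 * (c * p + 2 * r / rho0 * Sp).
  by rewrite -rcE; exact: fardens_bound.
have bn t : `|fardens mn r r1 B z0 t| <= pi^-1 * (c * n + 2 * r / rho0 * Sn).
  by rewrite -rcE; exact: fardens_bound.
pose ka := 2 * (r * Kh) + (pi^-1 * (c * p + 2 * r / rho0 * Sp) +
                           pi^-1 * (c * n + 2 * r / rho0 * Sn)).
have gdka t : `|gd t| <= ka.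
  apply: (le_trans (ler_normD _ _)); apply: lerD.
    rewrite normrM ger0_norm; last by rewrite mulr_ge0// ltW.
    have -> : 2 * (r * Kh) = 2 * pi * (pi^-1 * (r * Kh)).
      by rewrite -mulrA mulVKf// gt_eqF.
    by rewrite ler_wpM2l// mulr_ge0// ltW.
  by apply: (le_trans (ler_normB _ _)); exact: lerD.
have cnd : continuous (ndens r f) by exact: continuous_ndens hf.
have mgd : measurable_fun (`[0, 2 * pi]%classic : set (measurableTypeR R)) gd.
  apply: measurable_funD.
    apply: measurable_funM => //.
    by apply: measurable_funTS; exact: continuous_measurable_fun.
  by apply: measurable_funB; exact: measurable_fardens.
have [s1 [s2 [circ0 s12 ints]]] := circle_charge r z0 mgd gdka.
pose omt : {charge set (R * R)%type -> \bar R} := cadd (crestr0 omega (mQ r1))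
  (cadd (charge_of_finite_measure s1) (copp (charge_of_finite_measure s2))).
have omtE A : measurable A ->
    (omt A = omega (A `&` Qdisc z0 r1) + (s1 A - s2 A))%E.
  move=> mA; rewrite -[LHS]/(crestr0 omega (mQ r1) A + (s1 A - s2 A))%E.
  by rewrite /crestr0 mem_set.
have Dcirc t : cdist (z0 + circ r t) z0 = r.
  by rewrite cdistE (addrC z0) addrK cnorm_circ// ltW.
exists delta, (h z0 + (2 * pi)^-1 *
  (\int[jpos omega]_(w in Qdisc z0 B `\` Qdisc z0 r1) ln (cdist z0 w) -
   \int[jneg omega]_(w in Qdisc z0 B `\` Qdisc z0 r1) ln (cdist z0 w))), omt.
split => //; split.
- move=> w /closure_Qdisc/= wd; apply: DM; apply: (le_lt_trans wd); lra.
- move=> A mA AD; rewrite omtE// setIidl; last first.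
    by move=> w /AD; rewrite /Qdisc/= => h1; lra.
  have [|-> ->] := circ0 A; last by rewrite sube0 adde0.
  by move=> t /AD; rewrite /Qdisc/= Dcirc; lra.
- move=> A mA AD; rewrite omtE// (_ : A `&` _ = set0); last first.
    apply/seteqP; split => w //= -[/AD nw wr1]; apply: nw.
    exact: lt_trans r1d.
  rewrite charge0; have [|-> ->] := circ0 A; last by rewrite sube0 adde0.
  by move=> t /AD; apply; rewrite /Qdisc/= Dcirc; lra.
(* A set inside radius [r1 <= rho0] that avoids [z0] sees only the punctured disc of radius
   [rho0]. *)
- have mass (m : {finite_measure set (R * R)%type -> \bar R}) A : measurable A ->
      A `<=` Qdisc z0 (delta * (1 + eta)) `\ z0 ->
      (m (A `&` Qdisc z0 r1) <= (fine (m (Qdisc z0 rho0 `\ z0)))%:E)%E.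
    move=> mA As; rewrite fineK ?fin_num_measure//.
    apply: le_measure; rewrite ?inE//; first exact: measurableI.
    move=> w [/As[_ wz] w1]; split => //; exact: lt_le_trans r1rho.
  apply: (@le_lt_trans _ _ ((p + ka * (2 * pi))%:E + (n + ka * (2 * pi))%:E)%E).
    apply: tvar_le => // A mA As; rewrite omtE//.
      rewrite EFinD; apply: leeD; last by apply: le_trans (lee_abs _) _; exact: s12.
      have mAQ : measurable (A `&` Qdisc z0 r1) by exact: measurableI.
      exact: (le_trans (charge_le_jpos omega mAQ) (mass mp A mA As)).
    have mAQ : measurable (A `&` Qdisc z0 r1) by exact: measurableI.
    rewrite fin_num_oppeD; last by rewrite fin_numB !fin_num_measure.
    rewrite EFinD; apply: leeD.
      exact: (le_trans (chargeN_le_jneg omega mAQ) (mass mn A mA As)).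
    by apply: le_trans (lee_abs _) _; rewrite abseN; exact: s12.
  rewrite -EFinD lte_fin.
  (* The circle charge is counted once for each sign, hence the factor 2; terms with [r] collect in
     [X], those with [c] in [4 * c * (p + n)]. *)
  have kaE : 2 * (ka * (2 * pi)) = X * r + 4 * c * (p + n).
    by rewrite /ka /X; move: pi pi0 => Pi Pi0; field; rewrite !gt_eqF.
  have h1 : (1 + 4 * c) * (p + n) < (1 + 4 * c) * (e1 + e1).
    by rewrite ltr_pM2l; [lra|lra].
  rewrite e1E in h1; nra.
- move=> z zd defz _.
  have zr : cdist z z0 < r by exact: lt_trans dr.
  apply: (@swept_potential R M h omega omt s1 s2 z0 rhoM r r1 B) => //.
  exists (Num.max (pi^-1 * (r * Kh)) (Num.max (pi^-1 * (c * p + 2 * r / rho0 * Sp))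
    (pi^-1 * (c * n + 2 * r / rho0 * Sn)))) => t.
  by rewrite !le_max bnd bp bn !orbT.
Qed.
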